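(* Let $G$ be a finite group with exactly two irredundant covers, i.e. $\beta(G)=2$. A) If $G$ is nilpotent, then $G$ is isomorphic to one of the following groups: i) $(\mathbb{Z}_{p^2}\rtimes \mathbb{Z}_p)\times \mathbb{Z}_n$, where $p>2$ is prime and $\gcd(p,n)=1$; ii) $\mathbb{Z}_4\times \mathbb{Z}_2\times \mathbb{Z}_n$, where $n$ is odd. B) If $G$ is not nilpotent, then $G$ is isomorphic to one of the following groups: iii) $\mathbb{Z}_{p^t}\rtimes \mathbb{Z}_n$, where $p$ is prime, $t\ge 1$, $\gcd(p,n)=1$, $\mathbb{Z}_n$ centralizes the subgroup $\mathbb{Z}_{p^{t-1}}$ of $\mathbb{Z}_{p^t}$ of order $p^{t-1}$, and $\mathbb{Z}_n$ acts on $\mathbb{Z}_{p^t}$ by an automorphism of order $q^2$ for some prime $q$; iv) $\mathbb{Z}_p^2\rtimes \mathbb{Z}_n$, where $p$ is prime, $\gcd(p,n)=1$, and $\mathbb{Z}_n$ acts irreducibly on $\mathbb{Z}_p^2$ by an automorphism of prime order; v) $Q_8\rtimes \mathbb{Z}_n$, where $n$ is odd and $\mathbb{Z}_n$ acts on $Q_8$ by an automorphism of order $3$.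
   Context: A cover of a finite group $G$ is a finite collection (set) $\{H_i\}_{i=1}^m$ of proper subgroups of $G$ with $G=\bigcup_{i=1}^m H_i$. A cover is irredundant if it contains no proper subcover, i.e. $\bigcup_{i\ne j}H_i\neq G$ for every $j$. $\beta(G)$ denotes the number of distinct irredundant covers of $G$ (with $\beta(G)=0$ when $G$ is cyclic). $\mathbb{Z}_n$ is the cyclic group of order $n$ ($n\ge 1$), $Q_8$ is the quaternion group of order $8$, and $K\rtimes H$ denotes a semidirect product with normal factor $K$; the direct product $K\times H$ is included as the case of trivial action. Saying that $\mathbb{Z}_n$ acts on $K$ by an automorphism of order $r$ means that a generator of $\mathbb{Z}_n$ acts on $K$ by an automorphism of order $r$. An action on $\mathbb{Z}_p^2$ is irreducible if the only subgroups of $\mathbb{Z}_p^2$ it preserves are the trivial subgroup and $\mathbb{Z}_p^2$. *)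

(* Defs.v *)
From mathcomp Require Import all_boot all_fingroup all_algebra all_solvable.

Set Implicit Arguments.
Unset Strict Implicit.
Unset Printing Implicit Defensive.

Import GroupScope.

(* A trivial G has no cover: it has no proper subgroup and an empty union is
   set0, which differs from G. *)
Definition subgroup_cover (gT : finGroupType) (G : {group gT})
    (C : {set {group gT}}) : bool :=
  [forall H in C, H \proper G] && (\bigcup_(H in C) H == G :> {set gT}).

Definition irredundant_cover (gT : finGroupType) (G : {group gT})
    (C : {set {group gT}}) : bool :=
  subgroup_cover G C &&
  [forall H in C, \bigcup_(K in C :\ H) K != G :> {set gT}].

Definition num_irredundant_covers (gT : finGroupType) (G : {group gT}) : nat :=
  #|[set C : {set {group gT}} | irredundant_cover G C]|.

(* The carrier of an action by group automorphisms is fixed pointwise outside R,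
   so the order of the permutation actperm to x is that of the automorphism
   of R induced by x. *)
Definition acts_with_order (aT rT : finGroupType) (D : {group aT})
    (R : {group rT}) (to : groupAction D R) (r : nat) : Prop :=
  exists2 x, generator D x & #[actperm to x] = r.

(* Zp n is the cyclic group of order n for every n >= 1, including n = 1
   (unlike the type 'Z_n).  In each family below n = 0 is excluded by the
   coprimality or parity hypothesis. *)

Definition family_i (gT : finGroupType) (G : {group gT}) : Prop :=
  exists p n : nat, exists to : groupAction (Zp p) (Zp (p ^ 2)%N),
    [/\ prime p, 2 < p, coprime p n
      & G \isog setX [set: sdprod_by to] (Zp n)].

Definition family_ii (gT : finGroupType) (G : {group gT}) : Prop :=
  exists2 n : nat, odd n & G \isog setX (setX (Zp 4) (Zp 2)) (Zp n).

Definition family_iii (gT : finGroupType) (G : {group gT}) : Prop :=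
  exists p t n : nat, exists to : groupAction (Zp n) (Zp (p ^ t)%N),
    [/\ [/\ prime p, 1 <= t & coprime p n],
        (forall U : {group 'Z_(p ^ t)%N},
           U \subset Zp (p ^ t)%N -> #|U| = (p ^ t.-1)%N ->
           Zp n \subset 'C(U | to)),
        (exists2 q : nat, prime q & acts_with_order to (q ^ 2)%N)
      & G \isog [set: sdprod_by to]].

Definition family_iv (gT : finGroupType) (G : {group gT}) : Prop :=
  exists p n : nat, exists to : groupAction (Zp n) (setX (Zp p) (Zp p)),
    [/\ prime p /\ coprime p n,
        acts_irreducibly (Zp n) (setX (Zp p) (Zp p)) to,
        (exists2 q : nat, prime q & acts_with_order to q)
      & G \isog [set: sdprod_by to]].

Definition family_v (gT : finGroupType) (G : {group gT}) : Prop :=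
  exists n : nat, exists to : groupAction (Zp n) 'Q_8,
    [/\ odd n, acts_with_order to 3 & G \isog [set: sdprod_by to]].

(* Main.v *)
(* The maximal cyclic subgroups of a noncyclic G form an irredundant cover, and
   replacing those contained in a proper noncyclic subgroup H by H gives another
   one as soon as H contains a maximal cyclic subgroup. Hence, when there are
   exactly two irredundant covers, exactly one such H exists; it is therefore
   normal of prime index, the maximal cyclic subgroups B outside H are maximal
   subgroups of G, and a maximal cyclic C inside H has no overgroup but C, H, G.
   In the nilpotent case this reduces to a Sylow p-subgroup, where the indices
   of the maximal cyclic subgroups are at most p^2. Otherwise every B outside H
   is self-normalizing and meets its other conjugates inside Z(G). If some B
   meets H outside Z(G), a counting argument makes C normal in G and yields
   iii). If not, the Frattini argument produces a normal Sylow p-subgroup P of H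
   with P Z(G) = H on which some B acts, and P is Z_p^2 or Q_8. *)
Require Import Defs.
From mathcomp Require Import all_boot all_fingroup all_algebra all_solvable.

Set Implicit Arguments.
Unset Strict Implicit.
Unset Printing Implicit Defensive.

Import GroupScope.

(** * Irredundant covers and maximal cyclic subgroups *)

(** In the nonnilpotent case the engine is that a noncentral element [d] of a maximal cyclic [A]
    outside [H] has centralizer exactly [A], since [A] is abelian and maximal. This makes [A] a
    trivial-intersection subgroup modulo the center, and a normal subgroup of [G] is either central
    or a supplement of [A]. The order of the action in families iii) to v) is always [#|A : 'Z(G)|].
    If [A :&: H] is not central, sending [E] to [C <*> E] embeds the subgroups between ['Z(G)] and
    [A] into [C], [H], [G]; exactly three subgroups remain, which forces an index [q ^ 2]. If
    [A :&: H] is central, the index is [#|G : H|], a prime. In the first case the obstacle is the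
    normality of [C]: uniqueness of [H] says nothing about the conjugates of [C], hence the
    counting. *)

Definition maxcyclic (gT : finGroupType) (G B : {group gT}) : bool :=
  [max B | (B \subset G) && cyclic B].

(** Containing a maximal cyclic [C] keeps [K] irredundant when it replaces the maximal cyclic
    subgroups below it: a generator of [C] lies in no other member of the new cover. Noncyclicity
    makes the new cover differ from the old one. *)
Definition pivotal (gT : finGroupType) (G K : {group gT}) : bool :=
  [&& K \proper G, ~~ cyclic K
    & [exists C : {group gT}, maxcyclic G C && (C \subset K)]].

Section MaximalCyclic.

Variables (gT : finGroupType) (G : {group gT}).
Implicit Types B C K : {group gT}.

Lemma maxcyclic_sub B : maxcyclic G B -> B \subset G.
Proof. by case/maxgroupP=> /andP[]. Qed.

Lemma maxcyclic_cyclic B : maxcyclic G B -> cyclic B.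
Proof. by case/maxgroupP=> /andP[]. Qed.

Lemma maxcyclic_max B K :
  maxcyclic G B -> K \subset G -> cyclic K -> B \subset K -> K :=: B.
Proof. by case/maxgroupP=> _ maxB sKG cK sBK; apply: maxB; rewrite ?sKG. Qed.

Lemma maxcyclic_exists x : x \in G -> {B | maxcyclic G B & x \in B}.
Proof.
move=> Gx; have P: (<[x]> \subset G) && cyclic <[x]>.
  by rewrite cycle_subG Gx cycle_cyclic.
have [B maxB sxB] :=
  maxgroup_exists (gP := fun K : {group gT} => (K \subset G) && cyclic K) P.
by exists B; rewrite // -cycle_subG.
Qed.

Lemma maxcyclicJ B x : x \in G -> maxcyclic G B -> maxcyclic G (B :^ x)%G.
Proof.
move=> Gx mB; apply/maxgroupP; rewrite /= cyclicJ (maxcyclic_cyclic mB) andbT.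
split=> [|K /andP[sKG cK]]; first by rewrite conj_subG ?(maxcyclic_sub mB).
rewrite /= sub_conjg => sBK; apply: (canRL (conjsgKV x)).
apply: (maxcyclic_max (K := (K :^ x^-1)%G) mB); rewrite /= ?cyclicJ //.
  by rewrite conj_subG ?groupV.
Qed.

Lemma pivotalJ K x : x \in G -> pivotal G K -> pivotal G (K :^ x)%G.
Proof.
move=> Gx /and3P[pKG ncK /existsP[C /andP[mC sCK]]].
apply/and3P; split; first by rewrite /= -{1}(conjGid Gx) properJ.
  by rewrite cyclicJ.
by apply/existsP; exists (C :^ x)%G; rewrite maxcyclicJ //= conjSg.
Qed.

End MaximalCyclic.

Section Covers.

Variables (gT : finGroupType) (G : {group gT}).
Implicit Types B C K H : {group gT}.

Lemma irredundant_coverP (D : {set {group gT}}) :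
  reflect [/\ {in D, forall K : {group gT}, K \proper G},
              {in G, forall x, exists2 K, K \in D & x \in K}
            & {in D, forall K : {group gT}, exists2 x, x \in G
                & forall L : {group gT}, L \in D -> x \in L -> L = K}]
          (irredundant_cover G D).
Proof.
apply: (iffP andP) => [[/andP[/forall_inP pD /eqP defG] /forall_inP irrD]|].
  split=> // [x|K DK]; first by rewrite -{1}defG => /bigcupP.
  have: ~~ (G \subset \bigcup_(L in D :\ K) L).
    apply: contra (irrD K DK) => sG; rewrite eqEsubset sG andbT.
    by apply/bigcupsP=> L /setD1P[_ /pD/proper_sub].
  case/subsetPn=> x Gx notDx; exists x => // L DL Lx.
  apply/eqP; apply: contraR notDx => neqLK.
  by apply/bigcupP; exists L; rewrite // !inE neqLK.
case=> pD covD irrD; split; first (apply/andP; split).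
- by apply/forall_inP.
- rewrite eqEsubset; apply/andP; split.
    by apply/bigcupsP=> K /pD/proper_sub.
  by apply/subsetP=> x /covD[K DK Kx]; apply/bigcupP; exists K.
apply/forall_inP=> K /irrD[x Gx uniqK]; apply: contraTneq Gx => <-.
apply/negP=> /bigcupP[L /setD1P[neqLK DL] Lx].
by rewrite (uniqK L) ?eqxx in neqLK.
Qed.

Let M := [set B : {group gT} | maxcyclic G B].
Let N H := H |: [set B : {group gT} | maxcyclic G B & ~~ (B \subset H)].

Hypothesis ncG : ~~ cyclic G.

Lemma maxcyclic_proper B : maxcyclic G B -> B \proper G.
Proof.
move=> mB; rewrite properEneq (maxcyclic_sub mB) andbT.
by apply: contraNneq ncG => <-; apply: maxcyclic_cyclic mB.
Qed.

Lemma maxcyclic_cover : irredundant_cover G M.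
Proof.
apply/irredundant_coverP; split=> [K|x Gx|K]; rewrite ?inE.
- exact: maxcyclic_proper.
- by have [B mB Bx] := maxcyclic_exists Gx; exists B; rewrite ?inE.
move=> mK; have [x defK] := cyclicP (maxcyclic_cyclic mK).
exists x => [|L]; first by rewrite -cycle_subG -defK maxcyclic_sub.
rewrite inE => mL; rewrite -cycle_subG -defK => sKL; apply: group_inj.
exact: maxcyclic_max mK (maxcyclic_sub mL) (maxcyclic_cyclic mL) sKL.
Qed.

Lemma pivotal_cover H : pivotal G H -> irredundant_cover G (N H).
Proof.
case/and3P=> pHG ncH /existsP[C /andP[mC sCH]].
apply/irredundant_coverP; split=> [K|x Gx|K].
- by case/setU1P=> [->|] //; rewrite inE => /andP[/maxcyclic_proper].
- have [Hx | notHx] := boolP (x \in H); first by exists H; rewrite ?setU11.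
  have [B mB Bx] := maxcyclic_exists Gx; exists B => //.
  rewrite !inE mB orbC /=; apply/orP; left.
  by apply: contra notHx => /subsetP->.
case/setU1P=> [-> | ].
  have [x defC] := cyclicP (maxcyclic_cyclic mC).
  exists x => [|L]; first by rewrite -cycle_subG -defC maxcyclic_sub.
  case/setU1P=> [-> | ] //; rewrite inE => /andP[mL nsLH].
  rewrite -cycle_subG -defC => sCL; case/negP: nsLH.
  by rewrite (maxcyclic_max mC (maxcyclic_sub mL) (maxcyclic_cyclic mL) sCL).
rewrite inE => /andP[mK nsKH].
have [x defK] := cyclicP (maxcyclic_cyclic mK).
exists x => [|L]; first by rewrite -cycle_subG -defK maxcyclic_sub.
case/setU1P=> [-> | ]; first by rewrite -cycle_subG -defK (negPf nsKH).
rewrite inE -cycle_subG -defK => /andP[mL _] sKL; apply: group_inj.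
exact: maxcyclic_max mK (maxcyclic_sub mL) (maxcyclic_cyclic mL) sKL.
Qed.

(** A generator of a maximal cyclic [B] lies in some member, which then contains [B] and, not being
    pivotal, is cyclic and equals [B]. So [D] contains [M], and as [M] already covers, irredundancy
    leaves room for nothing else. *)
Lemma irredundant_cover_no_pivotal (D : {set {group gT}}) :
  (forall K, ~~ pivotal G K) -> irredundant_cover G D -> D = M.
Proof.
move=> noP /irredundant_coverP[pD covD irrD].
have topD B: maxcyclic G B -> exists2 K, K \in D & B \subset K.
  move=> mB; have [x defB] := cyclicP (maxcyclic_cyclic mB).
  have Gx: x \in G by rewrite -cycle_subG -defB maxcyclic_sub.
  have [K DK Kx] := covD x Gx; exists K => //.
  by rewrite defB cycle_subG.
have cycD K B: K \in D -> maxcyclic G B -> B \subset K -> B = K.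
  move=> DK mB sBK; apply/esym/group_inj.
  apply: (maxcyclic_max mB (proper_sub (pD K DK)) _ sBK).
  apply: contraNT (noP K) => ncK; rewrite /pivotal pD //= ncK.
  by apply/existsP; exists B; rewrite mB.
have MD B: maxcyclic G B -> B \in D.
  by move=> mB; have [K DK sBK] := topD B mB; rewrite (cycD K B DK mB sBK).
apply/setP=> K; rewrite inE; apply/idP/idP=> [DK|]; last exact: MD.
have [x Gx uniqK] := irrD K DK; have [B mB Bx] := maxcyclic_exists Gx.
by rewrite -(uniqK B (MD B mB) Bx).
Qed.

End Covers.

Lemma num_irredundant_covers_cyclic (gT : finGroupType) (G : {group gT}) :
  cyclic G -> num_irredundant_covers G = 0.
Proof.
case/cyclicP=> x defG; apply/eqP; rewrite cards_eq0; apply/eqP/setP=> D.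
rewrite !inE; apply/negP=> /irredundant_coverP[pD covD _].
have [|K DK Kx] := covD x; first by rewrite defG cycle_id.
by have /andP[_ /negP[]] := pD K DK; rewrite defG cycle_subG.
Qed.

(* The maximal cyclic subgroups form an irredundant cover, and every pivotal
   H yields another one whose only noncyclic member is H; these are all the
   irredundant covers when there is no pivotal subgroup at all. *)
Lemma two_covers_pivotal (gT : finGroupType) (G : {group gT}) :
    num_irredundant_covers G = 2 ->
  ~~ cyclic G /\
  exists2 H, pivotal G H & forall K, pivotal G K -> K :=: H.
Proof.
move=> b2; have ncG: ~~ cyclic G.
  by apply: contra_eqN b2 => /num_irredundant_covers_cyclic->.
split=> //; set M := [set B : {group gT} | maxcyclic G B].
pose N (H : {group gT}) :=
  H |: [set B : {group gT} | maxcyclic G B & ~~ (B \subset H)].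
have [H pivH | noP] := pickP (pivotal G); last first.
  have: #|[set D | irredundant_cover G D]| <= #|[set M]|.
    apply/subset_leq_card/subsetP=> D; rewrite !inE => irrD; apply/eqP.
    by apply: irredundant_cover_no_pivotal => // K; rewrite noP.
  by rewrite cards1 -/(num_irredundant_covers G) b2.
exists H => // K pivK; have [//|neqKH] := eqVneq (K : {set gT}) H.
have ncyc L: pivotal G L -> ~~ cyclic L by case/and3P.
have neqM L: pivotal G L -> N L != M.
  move=> pL; apply: contraNneq (ncyc L pL) => eqLM.
  have: L \in M by rewrite -eqLM setU11.
  by rewrite inE => /maxcyclic_cyclic.
have neqN: N K != N H.
  apply: contraNneq (ncyc K pivK) => eqKH.
  have: K \in N H by rewrite -eqKH setU11.
  case/setU1P=> [eqK|]; first by rewrite eqK eqxx in neqKH.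
  by rewrite inE => /andP[/maxcyclic_cyclic].
have: #|[set M; N H; N K]| <= #|[set D | irredundant_cover G D]|.
  apply/subset_leq_card/subsetP=> D.
  case/setUP=> [/setUP[]|] /set1P->; rewrite inE.
  - exact: maxcyclic_cover.
  - exact: pivotal_cover.
  exact: pivotal_cover.
rewrite -/(num_irredundant_covers G) b2 -setUA cardsU1 cards2 !inE.
by rewrite !(eq_sym M) (negPf (neqM H pivH)) (negPf (neqM K pivK))
  (eq_sym (N H)) neqN.
Qed.

(** * Recognizing the families *)

Lemma isog_sdprod_by (gT aT rT : finGroupType) (D : {group aT})
    (R : {group rT}) (G : {group gT}) (f : {morphism R >-> gT})
    (h : {morphism D >-> gT}) :
    'injm f -> 'injm h -> f @* R ><| h @* D = G ->
  exists to : groupAction D R,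
    {in R & D, forall k a, f (to k a) = f k ^ h a}
    /\ G \isog [set: sdprod_by to].
Proof.
move=> injf injh defG; have [_ defRD nRD tiRD] := sdprodP defG.
(* Conjugation transported through [f] and [h]. The default [k] keeps each map injective for [a]
   outside [D] and supported on [R], as an action by automorphisms demands. *)
pose t k a := if (k \in R) && (a \in D) then invm injf (f k ^ h a) else k.
have Jf k a: k \in R -> a \in D -> f k ^ h a \in f @* R.
  move=> Rk Da; rewrite memJ_norm ?mem_morphim //.
  by rewrite (subsetP nRD) ?mem_morphim.
have tE k a: k \in R -> a \in D -> f (t k a) = f k ^ h a.
  by move=> Rk Da; rewrite /t Rk Da invmK ?Jf.
have tR k a: (t k a \in R) = (k \in R).
  rewrite /t; case: ifP => // /andP[Rk Da].
  by case/morphimP: (Jf k a Rk Da) => k' _ Rk' ->; rewrite invmE // Rk Rk'.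
have tD k a: a \notin D -> t k a = k by rewrite /t => /negPf->; rewrite andbF.
have tnR k a: k \notin R -> t k a = k by rewrite /t => /negPf->.
have act_t: is_action D t.
  split=> [a k1 k2 eq12 | k a b Da Db /=]; last first.
    have [Rk | nRk] := boolP (k \in R); last by rewrite !(tnR, tR).
    apply: (injmP injf); rewrite ?tR // !tE ?groupM ?tR //.
    by rewrite morphM // conjgM.
  have Rk12: (k1 \in R) = (k2 \in R) by rewrite -(tR k1 a) eq12 tR.
  have [Da | nDa] := boolP (a \in D); last by rewrite -(tD k1 a) // eq12 tD.
  have [Rk1 | nRk1] := boolP (k1 \in R); last first.
    by rewrite -(tnR k1 a) // eq12 tnR // -Rk12.
  apply: (injmP injf); rewrite -?Rk12 //.
  by apply: (conjg_inj (h a)); rewrite -!tE ?eq12 -?Rk12.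
have gact_t: is_groupAction R (Action act_t).
  move=> a Da; rewrite inE; apply/andP; split.
    by apply/subsetP=> k; rewrite inE actpermE /=; apply: contraR => /tnR->.
  apply/morphicP=> k1 k2 Rk1 Rk2; rewrite !actpermE /=.
  apply: (injmP injf); rewrite ?groupM ?tR ?groupM // tE ?groupM //.
  by rewrite !morphM ?tR // !tE // conjMg.
exists (GroupAction gact_t); split=> //.
have actf: {in R & D, morph_act (GroupAction gact_t) 'J f h} by exact: tE.
rewrite isog_sym; apply/isogP; exists (xsdprod_morphism actf).
  by rewrite injm_xsdprodm injf injh tiRD eqxx.
by rewrite im_xsdprodm defRD.
Qed.

Lemma isog_Zp (gT : finGroupType) (A : {group gT}) : cyclic A -> Zp #|A| \isog A.
Proof. by case/cyclicP=> a ->; apply: Zp_isog. Qed.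

Lemma isog_Zp2 (gT : finGroupType) (p : nat) (A : {group gT}) :
  p.-abelem A -> #|A| = (p ^ 2)%N -> prime p -> setX (Zp p) (Zp p) \isog A.
Proof.
move=> abelA oA pr_p; have oZ := card_Zp (prime_gt0 pr_p).
have abelZ: p.-abelem (Zp p) by rewrite prime_abelem ?oZ.
have abelZZ: p.-abelem (setX (Zp p) (Zp p)).
  rewrite (dprod_abelem p (setX_dprod _ _)).
  by rewrite -(isog_abelem (isog_setX1 _ _)) -(isog_abelem (isog_set1X _ _)) abelZ.
by rewrite (isog_abelem_card _ abelZZ) abelA cardsX oA oZ mulnn eqxx.
Qed.

(** The families speak of the order of an automorphism, the group arguments of an index; they agree
    because the kernel of the action corresponds to ['C_K(P)]. The maps [f] and [h] are returned so
    that conditions on subgroups can be carried over too. *)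
Lemma sdprod_by_model (gT aT rT : finGroupType) (D : {group aT})
    (R : {group rT}) (G P K : {group gT}) :
    P ><| K = G -> R \isog P -> D \isog K -> cyclic K ->
  exists to : groupAction D R,
  exists f : {morphism R >-> gT}, exists h : {morphism D >-> gT},
  [/\ 'injm f /\ f @* R = P, 'injm h /\ h @* D = K,
      {in R & D, forall k a, f (to k a) = f k ^ h a},
      acts_with_order to #|K : 'C_K(P)|
    & G \isog [set: sdprod_by to]].
Proof.
move=> defG /isogP[f injf fR] isoDK cycK; have /isogP[h injh hD] := isoDK.
have defG': f @* R ><| h @* D = G by rewrite fR hD.
have [to [fto isoG]] := isog_sdprod_by injf injh defG'.
exists to, f, h; split=> //.
have [x defD]: exists x, D :=: <[x]>.
  by apply/cyclicP; rewrite (isog_cyclic isoDK).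
exists x; first by rewrite /generator defD eqxx.
have Dx: x \in D by rewrite defD cycle_id.
rewrite orderE -morphim_cycle // -defD card_morphim setIid.
have <-: h @*^-1 'C_K(P) = 'ker (actperm to).
  rewrite ker_actperm; apply/setP=> a; rewrite !inE; apply: andb_id2l => Da.
  rewrite -{1}hD mem_morphim //=; apply/centP/subsetP=> [cPa k _ | ca k].
    rewrite inE; apply/eqP.
    have [Rk | nRk] := boolP (k \in R); last by rewrite gact_out.
    apply: (injmP injf); rewrite ?gact_stable // fto // /conjg -cPa ?mulKg //.
    by rewrite -fR mem_morphim.
  rewrite -fR => /morphimP[k' _ Rk' ->]; apply/commute_sym/commgP/conjg_fixP.
  by have := ca k' (in_setT _); rewrite inE => /eqP e; rewrite -fto ?e.
by rewrite -(index_injm _ injh) // ?morphpreK hD ?subsetIl // subsetIl.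
Qed.

Section FamilyIntro.

Variables (gT : finGroupType) (G P K : {group gT}).

Lemma family_i_intro (X Y N : {group gT}) (p : nat) :
    prime p -> 2 < p -> cyclic X -> #|X| = (p ^ 2)%N -> #|Y| = p ->
    X ><| Y = P -> cyclic N -> coprime p #|N| -> P \x N = G ->
  family_i G.
Proof.
move=> pr_p p_gt2 cycX oX oY defP cycN copN defG.
have cycY: cyclic Y by rewrite prime_cyclic ?oY.
have isoX := isog_Zp cycX; have isoY := isog_Zp cycY.
rewrite oX in isoX; rewrite oY in isoY.
have [to [f [h [_ _ _ _ isoP]]]] := sdprod_by_model defP isoX isoY cycY.
exists p, #|N|, to; split=> //.
apply: (isog_dprod defG (setX_dprod _ _)).
  exact: isog_trans isoP (isog_setX1 _ _).
by apply: isog_trans (isog_set1X _ _); rewrite isog_sym isog_Zp.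
Qed.

Lemma family_ii_intro (X Y N : {group gT}) :
    cyclic X -> #|X| = 4 -> #|Y| = 2 -> X \x Y = P ->
    cyclic N -> odd #|N| -> P \x N = G ->
  family_ii G.
Proof.
move=> cycX oX oY defP cycN oddN defG.
have cycY: cyclic Y by rewrite prime_cyclic ?oY.
exists #|N| => //; apply: (isog_dprod defG (setX_dprod _ _)); last first.
  by apply: isog_trans (isog_set1X _ _); rewrite isog_sym isog_Zp.
apply: isog_trans (isog_setX1 _ _).
apply: (isog_dprod defP (setX_dprod _ _)).
  by apply: isog_trans (isog_setX1 _ _); rewrite -oX isog_sym isog_Zp.
by apply: isog_trans (isog_set1X _ _); rewrite -oY isog_sym isog_Zp.
Qed.

Hypotheses (defG : P ><| K = G) (cycK : cyclic K).

Lemma family_iii_intro (p t q : nat) :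
    prime p -> 1 <= t -> coprime p #|K| -> cyclic P -> #|P| = (p ^ t)%N ->
    (forall U : {group gT}, U \subset P -> #|U| = (p ^ t.-1)%N ->
      K \subset 'C(U)) ->
    prime q -> #|K : 'C_K(P)| = (q ^ 2)%N ->
  family_iii G.
Proof.
move=> pr_p t_gt0 copK cycP oP cUK pr_q oKP.
have isoP := isog_Zp cycP; have isoK := isog_Zp cycK; rewrite oP in isoP.
have [to [f [h [[injf fR] [injh hD] toE oto isoG]]]] :=
  sdprod_by_model defG isoP isoK cycK.
exists p, t, #|K|, to; split=> // [U sUZ oU|]; last first.
  by exists q; rewrite -?oKP.
apply/subsetP=> a Za; rewrite !inE Za /=; apply/subsetP=> u Uu; rewrite inE.
have Zu := subsetP sUZ u Uu; apply/eqP; apply: (injmP injf) => //.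
  by rewrite gact_stable.
have /subsetP cK: K \subset 'C(f @* U).
  by apply: cUK; [rewrite -fR morphimS | rewrite card_injm].
have Kha: h a \in K by have := mem_morphim h Za Za; rewrite hD.
by rewrite toE // /conjg -(centP (cK _ Kha)) ?mulKg ?mem_morphim.
Qed.

Lemma family_iv_intro (p r : nat) :
    prime p -> coprime p #|K| -> p.-abelem P -> #|P| = (p ^ 2)%N ->
    (forall E : {group gT}, E \subset P -> K \subset 'N(E) ->
      E :=: 1 \/ E :=: P) ->
    prime r -> #|K : 'C_K(P)| = r ->
  family_iv G.
Proof.
move=> pr_p copK abelP oP irrK pr_r oKP.
have isoP := isog_Zp2 abelP oP pr_p; have isoK := isog_Zp cycK.
have [to [f [h [[injf fR] [injh hD] toE oto isoG]]]] :=
  sdprod_by_model defG isoP isoK cycK.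
exists p, #|K|, to; split=> //; last by exists r; rewrite // -oKP.
have oZ := card_isog isoP.
apply/mingroupP; split.
  rewrite -cardG_gt1 oZ oP -{1}(exp1n 2) ltn_exp2r ?prime_gt1 //=.
  apply/subsetP=> a Za; rewrite !inE Za; apply/subsetP=> u Zu.
  by rewrite inE gact_stable.
move=> L /andP[ntL actL] sLZ; apply/eqP; rewrite eqEcard sLZ.
have sfLP: f @* L \subset P by rewrite -fR morphimS.
have [|fL1|fLP] := irrK (f @* L)%G sfLP.
- apply/subsetP=> b Kb.
  have /morphimP[a _ Za ->]: b \in h @* Zp #|K| by rewrite hD.
  rewrite inE.
  apply/subsetP=> _ /imsetP[_ /morphimP[u _ Lu ->] ->].
  have Zu := subsetP sLZ u Lu.
  rewrite -toE // mem_morphim ?gact_stable //.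
  by have /subsetP/(_ a Za)/astabs_act-> := actL.
- by case/eqP: ntL; apply/trivgP; rewrite -(injmSK injf) // fL1 sub1G.
by rewrite oZ -fLP (card_injm injf) ?leqnn.
Qed.

Lemma family_v_intro :
  P \isog 'Q_8 -> odd #|K| -> #|K : 'C_K(P)| = 3 -> family_v G.
Proof.
rewrite isog_sym => isoP oddK oKP; have isoK := isog_Zp cycK.
have [to [f [h [_ _ _ oto isoG]]]] :=
  sdprod_by_model (R := 'Q_8%G) defG isoP isoK cycK.
by rewrite oKP in oto; exists #|K|, to; split.
Qed.

End FamilyIntro.

(** * The pivot subgroup *)

Definition pivot (gT : finGroupType) (G H : {group gT}) : Prop :=
  [/\ ~~ cyclic G, pivotal G H & forall K, pivotal G K -> K :=: H].

Lemma maximal_normal_index_prime (gT : finGroupType) (G H : {group gT}) :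
  maximal H G -> H <| G -> prime #|G : H|.
Proof.
move=> /maxgroupP[pHG maxH] nsHG; have [sHG nHG] := andP nsHG.
have ntGH: 1 < #|G / H| by rewrite card_quotient // indexg_gt1 proper_subn.
have pr_p := pdiv_prime ntGH; have [y GHy oy] := Cauchy pr_p (pdiv_dvd _).
suffices defG: coset H @*^-1 <[y]> = G.
  by rewrite -card_quotient // -defG cosetpreK -orderE oy.
apply/eqP; apply: contraTT pr_p => neqG; rewrite -oy orderE.
have sKG: coset H @*^-1 <[y]> \subset G.
  by rewrite -(quotientGK nsHG) morphpreS ?cycle_subG.
have := maxH (coset H @*^-1 <[y]>)%G _ (sub_cosetpre _).
rewrite properEneq neqG sKG => /(_ isT)/= defH.
have: coset H @*^-1 <[y]> / H = 1 by rewrite defH trivg_quotient.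
by rewrite cosetpreK => ->; rewrite cards1.
Qed.

Section PivotFacts.

Variables (gT : finGroupType) (G H : {group gT}).
Implicit Types B C K : {group gT}.
Hypothesis pivH : pivot G H.

Lemma pivot_noncyclic_group : ~~ cyclic G. Proof. by case: pivH. Qed.

Lemma pivot_proper : H \proper G. Proof. by case: pivH => _ /and3P[]. Qed.

Lemma pivot_noncyclic : ~~ cyclic H. Proof. by case: pivH => _ /and3P[]. Qed.

Lemma pivot_maxcyclic : exists2 C, maxcyclic G C & C \subset H.
Proof. by case: pivH => _ /and3P[_ _ /existsP[C /andP[]]]; exists C. Qed.

Lemma pivot_unique C K :
  maxcyclic G C -> C \subset K -> K \proper G -> ~~ cyclic K -> K :=: H.
Proof.
case: pivH => _ _ uniqH mC sCK pKG ncK; apply: uniqH.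
by rewrite /pivotal pKG ncK; apply/existsP; exists C; rewrite mC.
Qed.

Lemma pivot_normal : H <| G.
Proof.
rewrite /normal proper_sub ?pivot_proper //; apply/subsetP=> x Gx.
case: pivH => _ pH uniqH; rewrite inE; apply/subsetP=> y.
by rewrite -{2}(uniqH _ (pivotalJ Gx pH)).
Qed.

(** A proper overgroup of [H] inherits noncyclicity and a maximal cyclic subgroup, so it is
    pivotal. *)
Lemma pivot_maximal : maximal H G.
Proof.
apply/maxgroupP; split=> [|K pKG sHK]; first exact: pivot_proper.
have [C mC sCH] := pivot_maxcyclic.
apply: (pivot_unique mC (subset_trans sCH sHK) pKG).
by apply: contra pivot_noncyclic; apply: cyclicS.
Qed.

Lemma pivot_index_prime : prime #|G : H|.
Proof. exact: maximal_normal_index_prime pivot_maximal pivot_normal. Qed.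

Lemma maxcyclic_maximal B : maxcyclic G B -> ~~ (B \subset H) -> maximal B G.
Proof.
move=> mB nsBH; apply/maxgroupP; split=> [|K pKG sBK].
  by apply: maxcyclic_proper; rewrite ?pivot_noncyclic_group.
have [cycK | ncK] := boolP (cyclic K).
  exact: maxcyclic_max mB (proper_sub pKG) cycK sBK.
by case/negP: nsBH; rewrite -(pivot_unique mB sBK pKG ncK).
Qed.

Lemma over_maxcyclic C K :
    maxcyclic G C -> C \subset H -> C \subset K -> K \subset G ->
  [\/ K :=: C, K :=: H | K :=: G].
Proof.
move=> mC sCH sCK sKG; have [cycK | ncK] := boolP (cyclic K).
  by constructor 1; apply: maxcyclic_max mC sKG cycK sCK.
have [defK | neqKG] := eqVneq (K : {set gT}) G; first by constructor 3.
by constructor 2; apply: pivot_unique mC sCK _ ncK; rewrite properEneq neqKG.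
Qed.

Lemma maximal_over B K :
  maximal B G -> B \subset K -> K \subset G -> K :=: B \/ K :=: G.
Proof.
case/maxgroupP=> _ maxB sBK sKG.
have [defK | neqKG] := eqVneq (K : {set gT}) G; [by right | left].
by apply: maxB sBK; rewrite properEneq neqKG.
Qed.

Lemma maxcyclic_not_sub x :
  x \in G -> x \notin H -> exists2 B, maxcyclic G B & x \in B /\ ~~ (B \subset H).
Proof.
move=> Gx notHx; have [B mB Bx] := maxcyclic_exists Gx; exists B => //.
by split=> //; apply: contra notHx => /subsetP->.
Qed.

Lemma pivot_complement : exists2 x, x \in G & x \notin H.
Proof. by have /properP[_ [x]] := pivot_proper; exists x. Qed.

End PivotFacts.

Lemma two_covers_pivot (gT : finGroupType) (G : {group gT}) :
  num_irredundant_covers G = 2 -> exists H, pivot G H.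
Proof. by case/two_covers_pivotal=> ncG [H pH uniqH]; exists H. Qed.

(** * Nilpotent groups *)

(** ['Ohm_1(P)] equals ['Ohm_1(A)], of order [p]; a noncyclic [p]-group with a single subgroup of
    order [p] is generalized quaternion. *)
Lemma unique_prime_subgroup_quaternion (gT : finGroupType) (p : nat)
    (P A : {group gT}) :
    p.-group P -> ~~ cyclic P -> A \subset P -> cyclic A ->
    {in P, forall y, #[y] = p -> y \in A} ->
  p = 2 /\ exists2 n, 2 < n & P \isog 'Q_(2 ^ n).
Proof.
move=> pP ncP sAP cycA cApA; have ntP: P :!=: 1.
  by apply: contraNneq ncP => ->; apply: cyclic1.
have [pr_p p_dv_P _] := pgroup_pdiv pP ntP.
have [y Py oy] := Cauchy pr_p p_dv_P.
have ntA: A :!=: 1.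
  apply/trivgPn; exists y; first exact: cApA.
  by rewrite -order_gt1 oy prime_gt1.
have defO: 'Ohm_1(P) = 'Ohm_1(A).
  rewrite !Ohm1Eprime; congr <<_>>; apply/setP=> x; rewrite !inE.
  apply/andP/andP=> [[Px pr_x] | [Ax pr_x]]; last by rewrite (subsetP sAP).
  split=> //; apply: cApA => //; apply/eqP.
  by have := mem_p_elt pP Px; rewrite /p_elt pnatE.
have /(prime_Ohm1P pP ntP): #|'Ohm_1(P)| = p.
  by rewrite defO; apply: Ohm1_cyclic_pgroup_prime (pgroupS sAP pP) ntA.
by rewrite (negPf ncP) /= => /andP[/eqP-> /eqP/quaternion_classP].
Qed.

Lemma card_center_quaternion (gT : finGroupType) (n : nat) (P : {group gT}) :
  2 < n -> P \isog 'Q_(2 ^ n) -> #|'Z(P)| = 2.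
Proof.
move=> n_gt2 isoP; have [[x y] genP _] := generators_quaternion n_gt2 isoP.
by have [_ _ [_ -> _ _ _]] := quaternion_structure n_gt2 genP isoP.
Qed.

Lemma setU_group_proper (gT : finGroupType) (G A B : {group gT}) :
  A \proper G -> B \proper G -> exists2 x, x \in G & x \notin A :|: B.
Proof.
move=> pAG pBG; have [sAG sBG] := (proper_sub pAG, proper_sub pBG).
have [sAB | /subsetPn[a Aa nBa]] := boolP (A \subset B).
  have /properP[_ [x Gx nBx]] := pBG; exists x => //.
  by rewrite inE negb_or nBx andbT; apply: contra nBx => /(subsetP sAB).
have [sBA | /subsetPn[b Bb nAb]] := boolP (B \subset A).
  have /properP[_ [x Gx nAx]] := pAG; exists x => //.
  by rewrite inE negb_or nAx; apply: contra nAx => /(subsetP sBA).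
exists (a * b); first by rewrite groupM ?(subsetP sAG a) ?(subsetP sBG b).
by rewrite inE negb_or groupMl // nAb groupMr.
Qed.

(* An involution y outside A that did not centralize A would make every
   element of A y an involution, but E contains elements of order 4 there. *)
Lemma abelian_card8 (gT : finGroupType) (P A E : {group gT}) y :
    #|P| = 8 -> cyclic A -> #|A| = 4 -> A <| P -> cyclic E -> #|E| = 4 ->
    E \subset P -> ~~ (E \subset A) -> y \in P -> #[y] = 2 -> y \notin A ->
  abelian P.
Proof.
move=> oP cycA oA nsAP cycE oE sEP nsEA Py oy nAy.
have [sAP nAP] := andP nsAP; have nAY: y \in 'N(A) by apply: (subsetP nAP).
have involA u v: u \in A -> v \in A -> #[u] = 2 -> #[v] = 2 -> u = v.
  move=> Au Av ou ov; have: <[u]> == <[v]>.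
    by rewrite (eq_subG_cyclic cycA) ?cycle_subG // -!orderE ou ov.
  move/eqP=> eq_uv; have: u \in <[v]> by rewrite -eq_uv cycle_id.
  by rewrite cycle2g // !inE => /orP[/eqP u1 | /eqP//]; rewrite u1 order1 in ou.
have defPA: A :* y = P :\: A.
  apply/eqP; rewrite eqEcard card_rcoset oA cardsD (setIidPr sAP) oP oA andbT.
  apply/subsetP=> _ /rcosetP[a Aa ->]; rewrite inE groupMl // nAy.
  by rewrite groupM ?(subsetP sAP a).
have [e defE] := cyclicP cycE; have oe: #[e] = 4 by rewrite orderE -defE.
have nAe: e \notin A by rewrite -cycle_subG -defE.
have Pe: e \in P by rewrite -cycle_subG -defE.
have /rcosetP[a Aa def_e]: e \in A :* y by rewrite defPA inE nAe.
have y2: y * y = 1 by apply/eqP; rewrite -expg2 -order_dvdn oy.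
have yV: y^-1 = y by apply: (mulgI y); rewrite mulgV y2.
have e2E: e ^+ 2 = a * a ^ y.
  by rewrite expg2 def_e /conjg yV !mulgA.
have oe2: #[e ^+ 2] = 2 by rewrite orderXdiv oe.
have Ae2: e ^+ 2 \in A by rewrite e2E groupM // memJ_norm.
(* If [a] had order at most 2 it would be trivial or the unique involution [e ^+ 2] of [A]. It would
   then commute with [e], hence with [y], and [e ^+ 2 = a ^+ 2] would be trivial. *)
have aV: a ^+ 2 = 1 -> False.
  move=> a2; have ntE2: e ^+ 2 != 1 by rewrite -order_gt1 oe2.
  case/eqP: ntE2; have [a1 | nta] := eqVneq a 1.
    by rewrite e2E a1 conj1g mulg1.
  have oa: #[a] = 2 by apply: nt_prime_order.
  have ae2: a = e ^+ 2 by apply: involA.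
  have cae: commute a e by rewrite ae2; apply/commute_sym/commuteX.
  have cay: commute a y.
    by have := commuteM (commuteV (commute_refl a)) cae; rewrite def_e mulKg.
  by rewrite e2E conjgE cay mulKg -expg2 a2.
have oa: #[a] = 4.
  have: ~~ (#[a] %| 2) by apply/negP; rewrite order_dvdn => /eqP/aV.
  have: #[a] %| 2 ^ 2 by rewrite -[(2 ^ 2)%N]oA order_dvdG.
  by case/(dvdn_pfactor _ 2 (isT : prime 2)) => [[|[|[|m]]]] // _ ->.
(* By uniqueness of the involution of [A]. Comparison with [e ^+ 2 = a * a ^ y] shows that [y] fixes
   [a], a generator of [A]. *)
have a2E: a ^+ 2 = e ^+ 2.
  by apply: involA => //; [apply: groupX | rewrite orderXdiv oa].
have ay: a ^ y = a by apply: (mulgI a); rewrite -e2E -a2E.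
have defA: A :=: <[a]>.
  by apply/esym/eqP; rewrite eqEcard cycle_subG Aa oA -orderE oa.
have cAy: y \in 'C(A) by rewrite defA cent_cycle cent1C; apply/cent1P/commgP/conjg_fixP.
have defP: P :=: A <*> <[y]>.
  rewrite norm_joinEr ?cycle_subG //; apply/eqP.
  rewrite eq_sym eqEsubset mul_subG ?cycle_subG //=; apply/subsetP=> x Px.
  have [Ax | nAx] := boolP (x \in A); first by rewrite -[x]mulg1 mem_mulg.
  have: x \in A :* y by rewrite defPA inE nAx.
  by case/rcosetP=> b Ab ->; rewrite mem_mulg ?cycle_id.
by rewrite defP abelianY (cyclic_abelian cycA) cycle_abelian cycle_subG.
Qed.

(** * The structure of p-groups with a pivot *)

Section PGroup.

Variables (gT : finGroupType) (p : nat) (P H : {group gT}).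
Implicit Types A B C D E : {group gT}.
Hypotheses (pP : p.-group P) (pivH : pivot P H).

Let ncP := pivot_noncyclic_group pivH.

Let ntP : P :!=: 1.
Proof. by apply: contraNneq ncP => ->; apply: cyclic1. Qed.

Let pr_p : prime p. Proof. by have [] := pgroup_pdiv pP ntP. Qed.

Lemma card_max_not_sub_pivot A :
  maxcyclic P A -> ~~ (A \subset H) -> #|P : A| = p.
Proof.
by move=> mA nsAH; apply: p_maximal_index pP (maxcyclic_maximal pivH mA nsAH).
Qed.

(** No subgroup lies strictly between [C] and [H], nor between [H] and [P]; each of the two steps
    has index [p]. *)
Lemma card_max_sub_pivot C : maxcyclic P C -> C \subset H -> #|P : C| = (p ^ 2)%N.
Proof.
move=> mC sCH; have maxH := pivot_maximal pivH.
have pHP := pivot_proper pivH; have sHP := proper_sub pHP.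
have maxC: maximal C H.
  apply/maxgroupP; split=> [|K pKH sCK].
    rewrite properEneq sCH andbT; apply: contraNneq (pivot_noncyclic pivH) => <-.
    exact: maxcyclic_cyclic mC.
  have sKP := subset_trans (proper_sub pKH) sHP.
  have [//|defK|defK] := over_maxcyclic pivH mC sCH sCK sKP.
    by rewrite defK properxx in pKH.
  by rewrite defK properE sHP andbF in pKH.
rewrite -(Lagrange_index sHP sCH) (p_maximal_index pP maxH).
by rewrite (p_maximal_index (pgroupS sHP pP) maxC).
Qed.

(** [X] is a maximal cyclic [A] outside [H], and [Y] a subgroup of order [p] avoiding it. Such a [Y]
    exists unless all elements of order [p] lie in [A]; then [P] would be quaternion, which the
    index [p ^ 2] of [C] excludes. *)
Lemma pgroup_pivot_structure :
  exists X Y : {group gT},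
    [/\ cyclic X /\ #|X| = (p ^ 2)%N, #|Y| = p, X ><| Y = P
      & p = 2 -> abelian P].
Proof.
have [x Px nHx] := pivot_complement pivH.
have [A mA [_ nsAH]] := maxcyclic_not_sub Px nHx.
have [C mC sCH] := pivot_maxcyclic pivH.
have maxA := maxcyclic_maximal pivH mA nsAH.
have nsAP := p_maximal_normal pP maxA; have [sAP nAP] := andP nsAP.
have cycA := maxcyclic_cyclic mA.
have iA := card_max_not_sub_pivot mA nsAH.
have iC := card_max_sub_pivot mC sCH.
(* An element outside both [A] and [H] yields a second maximal cyclic [E] outside [H], so that [P]
   is the product of [E] and [A]. *)
have [z Pz] := setU_group_proper (maxgroupp maxA) (pivot_proper pivH).
rewrite inE negb_or => /andP[nAz nHz].
have [E mE [Ez nsEH]] := maxcyclic_not_sub Pz nHz.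
have nsEA: ~~ (E \subset A) by apply: contra nAz => /subsetP->.
have maxE := maxcyclic_maximal pivH mE nsEH.
have nsEP := p_maximal_normal pP maxE; have [sEP nEP] := andP nsEP.
have cycE := maxcyclic_cyclic mE.
have iE := card_max_not_sub_pivot mE nsEH.
have defP: E * A = P.
  by rewrite (normC (subset_trans sEP nAP)) (mulg_normal_maximal nsAP).
have [cApA | ] := boolP [forall (y | (y \in P) && (#[y] == p)), y \in A].
  have [|p2 [n n_gt2 isoP]] := unique_prime_subgroup_quaternion pP ncP sAP cycA.
    by move=> y Py oy; have /forallP/(_ y) := cApA; rewrite Py oy eqxx.
  have oZ := card_center_quaternion n_gt2 isoP; rewrite p2 in iA iC iE.
  have oP: #|P| = (2 ^ n)%N by rewrite (card_isog isoP) card_quaternion.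
  have sEAZ: E :&: A \subset 'Z(P).
    rewrite subsetI subIset ?sEP //= -defP centM subsetI.
    rewrite (subset_trans (subsetIl _ _) (cyclic_abelian cycE)).
    exact: subset_trans (subsetIr _ _) (cyclic_abelian cycA).
  (* The center has order 2 and [#|A|] is twice [#|E :&: A|], so [#|A| <= 4] and [P] has order 8. *)
  have:= cardSg sEAZ; rewrite oZ => /dvdn_leq -/(_ isT) leEA.
  have := mul_cardG E A; rewrite defP -(Lagrange sEP) iE.
  rewrite -mulnA => /eqP; rewrite eqn_pmul2l // => /eqP oA.
  have := Lagrange sAP; rewrite iA oA oP => oEA.
  have oP8: (2 ^ n)%N = 8.
    apply/eqP; rewrite eqn_leq (@leq_pexp2l 2 3) // andbT -oEA.
    by rewrite mulnAC (leq_mul (leqnn 4) leEA).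
  (* [C] has index 4, hence order 2, and its involution lies in [A]; maximality gives [C = A],
     although [A] is not inside [H]. *)
  have := Lagrange (maxcyclic_sub mC); rewrite iC oP oP8 => oC8.
  have oC: #|C| = 2 by apply/eqP; rewrite -(eqn_pmul2r (m := 4)) ?oC8.
  case/negP: nsAH; rewrite (maxcyclic_max mC sAP cycA) //.
  have [c defC] := cyclicP (maxcyclic_cyclic mC).
  have Pc: c \in P by rewrite -cycle_subG -defC maxcyclic_sub.
  have /forallP/(_ c) := cApA.
  by rewrite Pc orderE -defC oC p2 eqxx defC cycle_subG.
case/forall_inPn=> y /andP[Py /eqP oy] nAy.
have [D mD Dy] := maxcyclic_exists Py.
(* A nontrivial intersection would contain the only subgroup of order [p] of the cyclic [D], which
   is [<[y]>]. *)
have tiAD: A :&: D = 1.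
  apply/eqP; apply: contraR nAy => ntAD.
  have pAD: p.-group (A :&: D) := pgroupS (subsetIl _ _) (pgroupS sAP pP).
  have [_ p_dv_AD _] := pgroup_pdiv pAD ntAD.
  have [u /setIP[Au Du] ou] := Cauchy pr_p p_dv_AD.
  have: <[u]> == <[y]>.
    by rewrite (eq_subG_cyclic (maxcyclic_cyclic mD)) ?cycle_subG // -!orderE ou oy.
  by move/eqP=> eq_uy; rewrite -cycle_subG -eq_uy cycle_subG.
have sDP := maxcyclic_sub mD; have oPA := Lagrange sAP.
have p_dv_D: p %| #|D| by rewrite -oy order_dvdG.
have oD: #|D| = p.
  apply/eqP; rewrite eqn_leq (dvdn_leq _ p_dv_D) // andbT -(leq_pmul2l (cardG_gt0 A)).
  by rewrite -TI_cardMg // -iA oPA subset_leq_card ?mul_subG.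
have defP': A ><| D = P.
  rewrite sdprodE ?(subset_trans sDP) //; apply/eqP.
  by rewrite eqEcard mul_subG //= TI_cardMg // oD -oPA iA.
have oA: #|A| = (p ^ 2)%N.
  apply/eqP; rewrite -(eqn_pmul2r (prime_gt0 pr_p)) -{1}iA oPA.
  (* [D] has order [p], and index [p ^ 2] if it lies in [H]. Otherwise its index is [p], so
     [#|P| = p ^ 2] and [C] would be trivial, which is not maximal cyclic. *)
  rewrite -(Lagrange sDP) oD; have [sDH | nsDH] := boolP (D \subset H).
    by rewrite (card_max_sub_pivot mD sDH) mulnC.
  have C1: C :=: 1.
    apply: card1_trivg; have := Lagrange (maxcyclic_sub mC).
    rewrite iC -(Lagrange sDP) oD (card_max_not_sub_pivot mD nsDH) mulnn.
    rewrite -{2}[(p ^ 2)%N]mul1n => /eqP.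
    by rewrite eqn_pmul2r ?expn_gt0 ?prime_gt0 // => /eqP.
  have := maxcyclic_max mC sDP (maxcyclic_cyclic mD).
  rewrite C1 sub1G => /(_ isT) D1.
  by have := oD; rewrite D1 cards1 => p1; have := pr_p; rewrite -p1.
exists A, D; split=> // p2.
have oP: #|P| = 8 by rewrite -oPA iA oA p2.
rewrite p2 in oy oA iE.
apply: (abelian_card8 (E := E) oP cycA oA nsAP cycE _ sEP nsEA Py oy nAy).
by apply/eqP; rewrite -(eqn_pmul2r (m := 2)) // -{1}iE Lagrange // oP.
Qed.

End PGroup.

Lemma index_dvd_card_normal (gT : finGroupType) (G K B : {group gT}) :
  G \subset 'N(K) -> B \subset G -> K <*> B = G -> #|G : B| %| #|K|.
Proof.
move=> nKG sBG; rewrite norm_joinEr ?(subset_trans sBG) // => defG.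
have := mul_cardG K B; rewrite defG -(Lagrange sBG) -mulnA.
rewrite mulnC => /eqP; rewrite eqn_pmul2l // => /eqP->.
exact: dvdn_mulr.
Qed.

(** * Reduction of nilpotent groups to a noncyclic Sylow subgroup *)

Section CoprimeDprod.

Variables (gT : finGroupType) (p : nat) (G P N : {group gT}).
Implicit Types K : {group gT}.
Hypotheses (defG : P \x N = G) (pP : p.-group P) (p'N : p^'.-group N).

Lemma cent_dprod_sub K : K \subset P -> N \subset 'C(K).
Proof. by case/dprodP: defG => _ _ cPN _ /centS; apply: subset_trans. Qed.

Lemma cyclic_join_compl K :
  cyclic N -> K \subset P -> cyclic K -> cyclic (K <*> N).
Proof.
move=> cycN sKP cycK; have cKN := cent_dprod_sub sKP.
by rewrite cent_joinEr // cyclicM // (coprimeSg sKP) // (pnat_coprime pP).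
Qed.

Lemma join_compl_cap K : K \subset P -> K <*> N :&: P = K.
Proof.
move=> sKP; rewrite cent_joinEr ?cent_dprod_sub // -group_modl // setIC.
by case/dprodP: defG => _ _ _ ->; rewrite mulg1.
Qed.

Lemma sub_cap_join_compl K : K \subset G -> K \subset (K :&: P) <*> N.
Proof.
move=> sKG; rewrite cent_joinEr ?cent_dprod_sub ?subsetIr //.
have [_ defPN cPN tiPN] := dprodP defG.
have [sPG sNG] : P \subset G /\ N \subset G.
  by rewrite -defPN mulG_subl mulG_subr.
have nsPG : P <| G.
  by rewrite /normal sPG -defPN mul_subG ?normG // cents_norm.
have nsNG : N <| G.
  by rewrite /normal sNG -defPN mul_subG ?normG // cents_norm // centsC.
apply/subsetP=> x Kx; have Gx := subsetP sKG x Kx.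
have hallP: p.-Hall(G) P.
  rewrite /pHall sPG pP -(mulKn #|G : P| (cardG_gt0 P)) Lagrange // -defPN.
  by rewrite TI_cardMg // mulKn.
have hallN: p^'.-Hall(G) N.
  rewrite /pHall sNG p'N -(mulKn #|G : N| (cardG_gt0 N)) Lagrange // -defPN.
  by rewrite TI_cardMg // mulnK // pnatNK.
rewrite -(consttC p x) mem_mulg //.
  by rewrite inE groupX //= (mem_normal_Hall hallP) ?p_elt_constt ?groupX.
by rewrite (mem_normal_Hall hallN) ?p_elt_constt ?groupX.
Qed.

End CoprimeDprod.

Section NilpotentReduction.

Variables (gT : finGroupType) (p : nat) (G H P N : {group gT}).
Implicit Types B C K : {group gT}.
Hypotheses (pivH : pivot G H) (defG : P \x N = G).
Hypotheses (pP : p.-group P) (p'N : p^'.-group N) (ncP : ~~ cyclic P).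

Let defPN : P * N = G. Proof. exact: (dprodW defG). Qed.
Let sPG : P \subset G. Proof. by rewrite -defPN mulG_subl. Qed.
Let sNG : N \subset G. Proof. by rewrite -defPN mulG_subr. Qed.
Let cPN : N \subset 'C(P). Proof. exact: (cent_dprod_sub defG). Qed.
Let coPN : coprime #|P| #|N|. Proof. exact: pnat_coprime pP p'N. Qed.
Let nPG : G \subset 'N(P).
Proof. by rewrite -defPN mul_subG ?normG // cents_norm. Qed.
Let nNG : G \subset 'N(N).
Proof. by rewrite -defPN mul_subG ?normG // cents_norm // centsC. Qed.

Let cyclic_joinN := cyclic_join_compl defG pP p'N.
Let joinN_capP := join_compl_cap defG.
Let sub_joinN := sub_cap_join_compl defG pP p'N.

(** Otherwise [N] and [B] generate [G], and so do [P] and [B] as [P] is not cyclic; then [#|G : B|]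
    divides the coprime numbers [#|N|] and [#|P|]. *)
Lemma pcore_compl_sub_maximal B : maximal B G -> cyclic B -> N \subset B.
Proof.
move=> maxB cycB; have sBG := proper_sub (maxgroupp maxB).
have join_max K: K \subset G -> ~~ (K \subset B) -> K <*> B = G.
  move=> sKG nsKB; have sKBG: K <*> B \subset G by rewrite join_subG sKG.
  have [defB|//] := maximal_over maxB (joing_subr K B) sKBG.
  by case/negP: nsKB; rewrite -defB joing_subl.
apply: contraR ncP => /(join_max N sNG) defNB.
have [sPB | /(join_max P sPG) defPB] := boolP (P \subset B).
  exact: cyclicS sPB cycB.
have: #|G : B| %| gcdn #|P| #|N| by rewrite dvdn_gcd !index_dvd_card_normal.
rewrite (eqP coPN) dvdn1 indexg_eq1 => sGB.
by have := maxgroupp maxB; rewrite properE sGB andbF.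
Qed.

Lemma pcore_compl_cyclic : cyclic N.
Proof.
have [x Gx nHx] := pivot_complement pivH.
have [A mA [_ nsAH]] := maxcyclic_not_sub Gx nHx.
have cycA := maxcyclic_cyclic mA; apply: cyclicS (cycA).
exact: pcore_compl_sub_maximal (maxcyclic_maximal pivH mA nsAH) cycA.
Qed.

Lemma maxcyclic_joinE B : maxcyclic G B -> (B :&: P) <*> N = B.
Proof.
move=> mB; have sBG := maxcyclic_sub mB.
apply: (maxcyclic_max (K := ((B :&: P) <*> N)%G) mB _ _ (sub_joinN sBG)).
  by rewrite join_subG sNG subIset ?sBG.
rewrite cyclic_joinN ?pcore_compl_cyclic ?subsetIr //.
exact: cyclicS (subsetIl _ _) (maxcyclic_cyclic mB).
Qed.

Lemma maxcyclic_capP B : maxcyclic G B -> maxcyclic P (B :&: P)%G.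
Proof.
move=> mB; apply/maxgroupP; split=> [|K /andP[sKP cycK] sBK].
  by rewrite subsetIr (cyclicS (subsetIl _ _) (maxcyclic_cyclic mB)).
rewrite -(joinN_capP sKP) /=; congr (_ :&: _).
apply: (maxcyclic_max (K := (K <*> N)%G) mB).
- by rewrite join_subG sNG (subset_trans sKP).
- by rewrite cyclic_joinN ?pcore_compl_cyclic.
by rewrite -{1}(maxcyclic_joinE mB) genS ?setSU.
Qed.

Lemma maxcyclic_joinN B : maxcyclic P B -> maxcyclic G (B <*> N)%G.
Proof.
move=> mB; have sBP := maxcyclic_sub mB.
apply/maxgroupP; split=> [|K /andP[sKG cycK] sBK].
  rewrite join_subG sNG (subset_trans sBP) //=.
  by rewrite cyclic_joinN ?pcore_compl_cyclic ?(maxcyclic_cyclic mB).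
apply/eqP; rewrite eqEsubset sBK andbT.
rewrite -(maxcyclic_max (K := (K :&: P)%G) mB) ?subsetIr ?sub_joinN //=.
  exact: cyclicS (subsetIl _ _) cycK.
by rewrite subsetI sBP (subset_trans (joing_subl _ N)).
Qed.

(** The maps [K <*> N] and [K :&: P] match the maximal cyclic subgroups of [P] with those of [G], so
    a pivotal subgroup of [P] extended by [N] is proper, noncyclic and above a maximal cyclic one,
    hence equal to [H]. *)
Lemma pivot_pcore : pivot P (H :&: P)%G.
Proof.
have [C mC sCH] := pivot_maxcyclic pivH.
have sHG := proper_sub (pivot_proper pivH).
have sNH: N \subset H.
  by apply: subset_trans sCH; rewrite -(maxcyclic_joinE mC) joing_subr.
split=> //.
  apply/and3P; split.
  - rewrite properE subsetIr subsetI subxx andbT; apply/negP=> sPH.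
    by have := pivot_proper pivH; rewrite properE sHG -defPN mul_subG.
  - apply: contra (pivot_noncyclic pivH) => cycHP.
    apply: (cyclicS (sub_joinN sHG)).
    by rewrite cyclic_joinN ?pcore_compl_cyclic ?subsetIr.
  by apply/existsP; exists (C :&: P)%G; rewrite maxcyclic_capP ?setSI.
move=> K /and3P[pKP ncK /existsP[D /andP[mD sDK]]].
have sKP := proper_sub pKP.
rewrite -(joinN_capP sKP) /=; congr (_ :&: _).
apply: (pivot_unique (K := (K <*> N)%G) pivH (maxcyclic_joinN mD)).
- by rewrite genS ?setSU.
- rewrite properEneq join_subG sNG (subset_trans sKP) // !andbT.
  apply: contraTneq pKP => defKN; rewrite properEneq sKP andbT negbK.
  by rewrite -(joinN_capP sKP) defKN (setIidPr sPG).
by apply: contra ncK => /(cyclicS (joing_subl K N)).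
Qed.

End NilpotentReduction.

Theorem nilpotent_pivot_family (gT : finGroupType) (G H : {group gT}) :
  nilpotent G -> pivot G H -> family_i G \/ family_ii G.
Proof.
move=> nilG pivH.
have /forall_inPn[V sylV ncV]: ~~ Zgroup G.
  apply: contra (pivot_noncyclic_group pivH) => ZG.
  exact: nil_Zgroup_cyclic ZG nilG.
have /andP[/p_groupP[p pr_p pV] /andP[sVG _]] := sylV.
have ncP: ~~ cyclic 'O_p(G).
  apply: contra ncV; apply: cyclicS.
  by rewrite (sub_Hall_pcore (nilpotent_pcore_Hall p nilG)).
have defG := nilpotent_pcoreC p nilG.
have [pP p'N] := (pcore_pgroup p G, pcore_pgroup p^' G).
have cycN := pcore_compl_cyclic pivH defG pP p'N ncP.
have pivP := pivot_pcore pivH defG pP p'N ncP.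
have coN: coprime p #|'O_p^'(G)|.
  by apply: pnat_coprime p'N; apply: pnat_id.
have [X [Y [[cycX oX] oY defP abP]]] := pgroup_pivot_structure pP pivP.
have [p2 | p'2] := eqVneq p 2; [right | left].
  apply: (@family_ii_intro _ G 'O_p(G)%G X Y 'O_p^'(G)%G) => //.
  - by rewrite oX p2.
  - by rewrite oY p2.
  - have [sXP sYP] : X \subset 'O_p(G) /\ Y \subset 'O_p(G).
      by case/sdprodP: defP => _ <- _ _; rewrite mulG_subl mulG_subr.
    by rewrite dprodEsd // (sub_abelian_cent2 (abP p2)).
  by move: coN; rewrite {1}p2 coprime2n.
apply: (@family_i_intro _ G 'O_p(G)%G X Y 'O_p^'(G)%G p) => //.
by rewrite ltn_neqAle eq_sym p'2 prime_gt1.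
Qed.

(** * Nonnilpotent groups *)

Section Nonnilpotent.

Variables (gT : finGroupType) (G H : {group gT}).
Implicit Types A B C K : {group gT}.
Hypotheses (pivH : pivot G H) (nnilG : ~~ nilpotent G).

Let nabG : ~~ abelian G.
Proof. by apply: contra nnilG => /abelian_nil. Qed.

Let sHG : H \subset G. Proof. exact: (proper_sub (pivot_proper pivH)). Qed.
Let nHG : G \subset 'N(H). Proof. by case/andP: (pivot_normal pivH). Qed.

Section NotInPivot.

Variable A : {group gT}.
Hypotheses (mA : maxcyclic G A) (nsAH : ~~ (A \subset H)).

Let maxA : maximal A G. Proof. exact: (maxcyclic_maximal pivH mA nsAH). Qed.
Let sAG : A \subset G. Proof. exact: (maxcyclic_sub mA). Qed.
Let abA : abelian A. Proof. exact: (cyclic_abelian (maxcyclic_cyclic mA)). Qed.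

Lemma join_not_sub K : K \subset G -> ~~ (K \subset A) -> K <*> A = G.
Proof.
move=> sKG nsKA; have sKAG: K <*> A \subset G by rewrite join_subG sKG.
have [defA|//] := maximal_over maxA (joing_subr K A) sKAG.
by case/negP: nsKA; rewrite -defA joing_subl.
Qed.

Lemma mul_not_sub K : K <| G -> ~~ (K \subset A) -> K * A = G.
Proof.
case/andP=> sKG nKG nsKA.
by rewrite -norm_joinEr ?join_not_sub // (subset_trans sAG).
Qed.

Lemma center_sub_maxcyclic : 'Z(G) \subset A.
Proof.
apply: contraR nabG => /join_not_sub <-; last exact: center_sub.
by rewrite abelianY center_abelian abA (subset_trans sAG) // centsC subsetIr.
Qed.

Lemma cent1_maxcyclic d : d \in A -> d \notin 'Z(G) -> 'C_G[d] = A.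
Proof.
move=> Ad nZd; have sAC: A \subset 'C_G[d].
  by rewrite subsetI sAG sub_cent1 (subsetP abA).
have [//|defG] := maximal_over maxA sAC (subsetIl _ _).
case/negP: nZd; rewrite inE (subsetP sAG) //= -sub_cent1.
by apply/setIidPl.
Qed.

Hypothesis nnA : ~~ (A <| G).

Lemma norm_maxcyclic : 'N_G(A) = A.
Proof.
have sAN: A \subset 'N_G(A) by rewrite subsetI sAG normG.
have [//|defG] := maximal_over maxA sAN (subsetIl _ _).
by case/negP: nnA; rewrite /normal sAG; apply/setIidPl.
Qed.

(** A noncentral [d] in both has centralizer [A], while the abelian [A :^ g] also centralizes it; so
    [g] normalizes [A], hence lies in [A]. *)
Lemma maxcyclic_TI g : g \in G -> g \notin A -> A :&: A :^ g \subset 'Z(G).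
Proof.
move=> Gg nAg; apply/subsetP=> d /setIP[Ad Agd]; apply: contraR nAg => nZd.
have sAgC: A :^ g \subset 'C_G[d].
  rewrite subsetI conj_subG //= sub_cent1.
  by apply: subsetP Agd; rewrite -abelianE abelianJ.
by rewrite (cent1_maxcyclic Ad nZd) in sAgC; rewrite -norm_maxcyclic inE Gg inE.
Qed.

Lemma normal_sub_center K : K <| G -> K \subset A -> K \subset 'Z(G).
Proof.
case/andP=> sKG nKG sKA; have /properP[_ [g Gg nAg]] := maxgroupp maxA.
apply: subset_trans (maxcyclic_TI Gg nAg); rewrite subsetI sKA.
by rewrite -(normP (subsetP nKG g Gg)) conjSg.
Qed.

End NotInPivot.

Lemma center_sub_pivot : 'Z(G) \subset H.
Proof.
have [C mC sCH] := pivot_maxcyclic pivH.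
apply: contraR nabG => nsZH.
have sCZG: C <*> 'Z(G) \subset G by rewrite join_subG center_sub maxcyclic_sub.
have abCZ: abelian (C <*> 'Z(G)).
  rewrite abelianY center_abelian (cyclic_abelian (maxcyclic_cyclic mC)).
  by rewrite subIset // centS ?orbT ?maxcyclic_sub.
have [defC|defH|defG] := over_maxcyclic pivH mC sCH (joing_subl _ _) sCZG.
- by case/negP: nsZH; apply: subset_trans sCH; rewrite -defC joing_subr.
- by case/negP: nsZH; rewrite -defH joing_subr.
by rewrite -defG.
Qed.

(** A cyclic normal subgroup lies in ['F(G)], which is proper here; it suffices to take an element
    outside both ['F(G)] and [H]. *)
Lemma exists_nonnormal_maxcyclic :
  exists2 A, maxcyclic G A & ~~ (A \subset H) /\ ~~ (A <| G).
Proof.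
have [pFG | ] := boolP ('F(G) \proper G); last first.
  rewrite properE Fitting_sub negbK => sGF; case/negP: nnilG.
  exact: nilpotentS sGF (Fitting_nil G).
have [x Gx] := setU_group_proper pFG (pivot_proper pivH).
rewrite inE negb_or => /andP[nFx nHx].
have [A mA [Ax nsAH]] := maxcyclic_not_sub Gx nHx; exists A => //.
split=> //; apply: contra nFx => nsAG; apply: subsetP Ax.
apply: Fitting_max nsAG _.
exact: abelian_nil (cyclic_abelian (maxcyclic_cyclic mA)).
Qed.

Lemma der1_sub_prime_index K : K <| G -> prime #|G : K| -> G^`(1) \subset K.
Proof.
case/andP=> sKG nKG prGK; rewrite der1_min // cyclic_abelian //.
by rewrite prime_cyclic // card_quotient.
Qed.

(** Beside a nonnormal [A], a normal [B] gives [G = B A] with [B :&: A] central. The derived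
    subgroup lies in [B :&: H]. If [B :&: H] is inside [A], then [A] is normal; if not, it
    supplements [A], and by Dedekind [B] is the product of [B :&: H] and [A :&: B], both inside
    [H]. *)
Lemma maxcyclic_nonnormal B :
  maxcyclic G B -> ~~ (B \subset H) -> ~~ (B <| G).
Proof.
move=> mB nsBH; apply/negP=> nsBG; have [sBG nBG] := andP nsBG.
have [A mA [nsAH nnA]] := exists_nonnormal_maxcyclic.
have maxA := maxcyclic_maximal pivH mA nsAH.
have maxB := maxcyclic_maximal pivH mB nsBH.
have sAG := maxcyclic_sub mA.
have derBH: G^`(1) \subset B :&: H.
  rewrite subsetI !der1_sub_prime_index ?(pivot_normal pivH) //.
    exact: pivot_index_prime pivH.
  exact: maximal_normal_index_prime.
have nsBA: ~~ (B \subset A).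
  apply: contra nnA => sBA; have [defA|defG] := maximal_over maxB sBA sAG.
    by rewrite (group_inj defA).
  by have := maxgroupp maxA; rewrite defG properxx.
have sBAZ: B :&: A \subset 'Z(G).
  have abA := cyclic_abelian (maxcyclic_cyclic mA).
  have abB := cyclic_abelian (maxcyclic_cyclic mB).
  rewrite subsetI subIset ?sBG //= -(mul_not_sub mA nsAH nsBG nsBA) centM.
  rewrite subsetI (subset_trans (subsetIl _ _) abB).
  exact: subset_trans (subsetIr _ _) abA.
have nsBHG: B :&: H <| G by rewrite normalI ?(pivot_normal pivH).
have [sBHA | nsBHA] := boolP (B :&: H \subset A).
  by case/negP: nnA; apply: sub_der1_normal; rewrite ?(subset_trans derBH).
case/negP: nsBH; have defG := mul_not_sub mA nsAH nsBHG nsBHA.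
rewrite -(setIidPr sBG) -defG -group_modl ?subsetIl // (setIC A).
by rewrite mul_subG ?subsetIr // (subset_trans sBAZ) ?center_sub_pivot.
Qed.

End Nonnilpotent.

(** * Splitting over a normal p-subgroup not contained in A *)

Section NormalPSubgroup.

Variables (gT : finGroupType) (p : nat) (G H A P : {group gT}).
Hypotheses (pivH : pivot G H) (nnilG : ~~ nilpotent G).
Hypotheses (mA : maxcyclic G A) (nsAH : ~~ (A \subset H)).
Hypotheses (pP : p.-group P) (nsPG : P <| G) (nsPA : ~~ (P \subset A)).
Hypothesis sZP : 'O_p('Z(G)) \subset P.

Let abA : abelian A. Proof. exact: (cyclic_abelian (maxcyclic_cyclic mA)). Qed.
Let sAG : A \subset G. Proof. exact: (maxcyclic_sub mA). Qed.
Let nilA : nilpotent A. Proof. exact: (abelian_nil abA). Qed.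
Let nnA := maxcyclic_nonnormal pivH nnilG mA nsAH.

(** Normalizers grow in the [p]-group [P <*> 'O_p(A)], so ['O_p(A)] is normalized by something
    outside the maximal [A], hence by [G]; normal subgroups inside [A] are central. *)
Lemma pcore_maxcyclic_central : 'O_p(A) \subset 'Z(G).
Proof.
set Ap := 'O_p(A); have sApA: Ap \subset A := pcore_sub p A.
have sApG := subset_trans sApA sAG; have [sPG nPG] := andP nsPG.
have nPAp : Ap \subset 'N(P) := subset_trans sApG nPG.
pose Q := (P <*> Ap)%G.
have pQ: p.-group Q by rewrite /= norm_joinEr // pgroupM pP pcore_pgroup.
have sQG: Q \subset G by rewrite join_subG sPG.
have nsNA: ~~ ('N_Q(Ap) \subset A).
  apply: contra nsPA => sNA.
  have sNAp: 'N_Q(Ap) \subset Ap.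
    rewrite (sub_Hall_pcore (nilpotent_pcore_Hall p nilA) sNA).
    exact: pgroupS (subsetIl _ _) pQ.
  have defQ := nilpotent_sub_norm (pgroup_nil pQ) (joing_subr P Ap) sNAp.
  by apply: subset_trans sApA; rewrite -[Ap]defQ joing_subl.
have sNG: 'N_G(Ap) \subset G := subsetIl _ _.
have nsApG: Ap <| G.
  rewrite /normal sApG; apply/setIidPl.
  have sAN: A \subset 'N_G(Ap) by rewrite subsetI sAG gFnorm.
  have maxA := maxcyclic_maximal pivH mA nsAH.
  have [defA|//] := maximal_over maxA sAN sNG.
  by case/negP: nsNA; rewrite -defA setSI.
exact: (normal_sub_center pivH mA nsAH nnA nsApG sApA).
Qed.

Lemma sdprod_pcore_compl : P ><| 'O_p^'(A) = G.
Proof.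
have [_ defA _ _] := dprodP (nilpotent_pcoreC p nilA).
have sApP: 'O_p(A) \subset P.
  apply: subset_trans sZP; apply: pcore_max (pcore_pgroup p A) _.
  rewrite /normal pcore_maxcyclic_central.
  have abZ := center_abelian G; rewrite cents_norm //.
  exact: subset_trans abZ (centS pcore_maxcyclic_central).
have defG := mul_not_sub pivH mA nsAH nsPG nsPA.
rewrite sdprodE.
- by rewrite -defG -{2}defA mulgA (mulGSid sApP).
- by rewrite (subset_trans (pcore_sub _ _)) ?(subset_trans sAG) ?normal_norm.
by apply: coprime_TIg; apply: pnat_coprime pP (pcore_pgroup _ _).
Qed.

Lemma cent_compl_center : 'C_('O_p^'(A))(P) = 'Z(G) :&: 'O_p^'(A).
Proof.
have sKA: 'O_p^'(A) \subset A := pcore_sub _ _.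
have defG := mul_not_sub pivH mA nsAH nsPG nsPA.
apply/eqP; rewrite eqEsubset !subsetI subsetIl subsetIr andbT !andbA andbT.
rewrite (subset_trans (subsetIl _ _)) ?(subset_trans sKA) //=.
rewrite -{1}defG centM subsetI subsetIr (subset_trans (subsetIl _ _)) /=; last first.
  exact: subset_trans sKA abA.
by rewrite subIset // subIset // centS ?orbT ?normal_sub.
Qed.

(** Converts the order of the automorphism induced on [P] into an index determined by the subgroup
    lattice: [A] is the product of ['Z(G)] and ['O_p^'(A)]. *)
Lemma index_cent_compl : #|'O_p^'(A) : 'C_('O_p^'(A))(P)| = #|A : 'Z(G)|.
Proof.
have [_ defA _ _] := dprodP (nilpotent_pcoreC p nilA).
have sZA := center_sub_maxcyclic pivH nnilG mA nsAH.
have sKA: 'O_p^'(A) \subset A := pcore_sub _ _.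
have defZK: 'Z(G) * 'O_p^'(A) = A.
  apply/eqP; rewrite eqEsubset mul_subG //= -{1}defA.
  by rewrite mulSg ?pcore_maxcyclic_central.
have := mul_cardG 'Z(G) 'O_p^'(A); rewrite defZK -(Lagrange sZA) -mulnA.
move/eqP; rewrite eqn_pmul2l // -cent_compl_center => /eqP oK.
have := Lagrange_index (subsetIl 'O_p^'(A) 'C(P)) (sub1G _); rewrite !indexg1 oK.
by rewrite mulnC => /eqP; rewrite mulnC eqn_pmul2r // => /eqP.
Qed.

End NormalPSubgroup.

(** Subgroups between [Z] and [A] correspond to divisors of [#|A : Z|], so this index has exactly
    three divisors. *)
Lemma cyclic_index_square (gT : finGroupType) (A Z F : {group gT}) :
    cyclic A -> Z \proper F -> F \proper A ->
    (forall E : {group gT}, Z \subset E -> E \subset A ->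
      [\/ E :=: Z, E :=: F | E :=: A]) ->
  exists2 q, prime q & #|A : Z| = (q ^ 2)%N.
Proof.
move=> cycA pZF pFA chain; have [sZF sFA] := (proper_sub pZF, proper_sub pFA).
have sZA := subset_trans sZF sFA.
have divE k: k %| #|A : Z| -> [\/ k = 1%N, k = #|F : Z| | k = #|A : Z|].
  move=> k_dv; have k_gt0: 0 < k by apply: dvdn_gt0 k_dv.
  have kZ_dv: #|Z| * k %| #|A| by rewrite -(Lagrange sZA) dvdn_pmul2l.
  have [a defA] := cyclicP cycA.
  (* The subgroup of order [#|Z| * k] of the cyclic [A]; it contains [Z] because [#|Z|] divides its
     order. *)
  pose E := <[a ^+ (#|A| %/ (#|Z| * k))]>%G.
  have oE: #|E| = (#|Z| * k)%N.
    have dv: #|A| %/ (#|Z| * k) %| #[a] by rewrite orderE -defA dvdn_div.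
    rewrite -orderE orderXdiv // orderE -defA -{1}(divnK kZ_dv) mulKn //.
    by rewrite divn_gt0 ?muln_gt0 ?cardG_gt0 // dvdn_leq.
  have sEA: E \subset A by rewrite defA cycleX.
  have sZE: Z \subset E by rewrite -(cardSg_cyclic cycA) // oE dvdn_mulr.
  have <-: #|E : Z| = k by rewrite -divgS // oE mulKn.
  by case: (chain E sZE sEA) => ->; rewrite ?indexgg; constructor.
have iF_gt1: 1 < #|F : Z| by rewrite indexg_gt1 proper_subn.
have iAF_gt1: 1 < #|A : F| by rewrite indexg_gt1 proper_subn.
have iA: (#|A : F| * #|F : Z|)%N = #|A : Z| by rewrite Lagrange_index.
have iFA: #|F : Z| < #|A : Z| by rewrite -iA -[ltnLHS]mul1n ltn_pmul2r.
have iA_gt1 := ltn_trans iF_gt1 iFA.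
pose q := pdiv #|A : Z|; have pr_q: prime q by rewrite pdiv_prime.
have q_dv: q %| #|A : Z| by rewrite pdiv_dvd.
have F_dv: #|F : Z| %| #|A : Z| by rewrite -iA dvdn_mull.
have defq: q = #|F : Z|.
  have [q1|//|defq] := divE q q_dv; first by rewrite q1 in pr_q.
  have := F_dv; rewrite -defq => /(prime_nt_dvdP pr_q) -> //.
  by rewrite neq_ltn iF_gt1 orbT.
exists q => //; have AF_dv: #|A : F| %| #|A : Z| by rewrite -iA dvdn_mulr.
have [i1|iAF|iAF] := divE _ AF_dv.
- by rewrite i1 in iAF_gt1.
- by rewrite -iA iAF -defq mulnn.
by move/eqP: iA; rewrite iAF -[eqbRHS]muln1 eqn_pmul2l // -defq gtn_eqF ?prime_gt1.
Qed.

(** * Some maximal cyclic A outside H meets H outside the center *)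

Section LargeIntersection.

Variables (gT : finGroupType) (G H A C : {group gT}).
Hypotheses (pivH : pivot G H) (nnilG : ~~ nilpotent G).
Hypotheses (mA : maxcyclic G A) (nsAH : ~~ (A \subset H)).
Hypotheses (nsAHZ : ~~ (A :&: H \subset 'Z(G))).
Hypotheses (mC : maxcyclic G C) (sCH : C \subset H).

Local Notation Z := 'Z(G).
Let sHG : H \subset G. Proof. exact: (proper_sub (pivot_proper pivH)). Qed.
Let nsHG : H <| G. Proof. exact: (pivot_normal pivH). Qed.
Let sZH : Z \subset H. Proof. exact: (center_sub_pivot pivH nnilG). Qed.
Let sAG : A \subset G. Proof. exact: (maxcyclic_sub mA). Qed.
Let cycA : cyclic A. Proof. exact: (maxcyclic_cyclic mA). Qed.
Let abA : abelian A. Proof. exact: (cyclic_abelian cycA). Qed.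
Let sCG : C \subset G. Proof. exact: (maxcyclic_sub mC). Qed.
Let cycC : cyclic C. Proof. exact: (maxcyclic_cyclic mC). Qed.
Let abC : abelian C. Proof. exact: (cyclic_abelian cycC). Qed.
Let sZA : Z \subset A.
Proof. exact: (center_sub_maxcyclic pivH nnilG mA nsAH). Qed.
Let nnA : ~~ (A <| G). Proof. exact: (maxcyclic_nonnormal pivH nnilG mA nsAH). Qed.
Let pivot_not_subA : ~~ (H \subset A).
Proof. by apply: contra (pivot_noncyclic pivH) => /cyclicS->. Qed.

(** For [d] noncentral in [A :&: H], the center of [H] lies in ['C_G[d] = A] and is normal in
    [G]. *)
Lemma center_pivot_sub : 'Z(H) \subset Z.
Proof.
have [d /setIP[Ad Hd] nZd] := subsetPn nsAHZ.
apply: (normal_sub_center pivH mA nsAH nnA).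
  exact: char_normal_trans (center_char H) nsHG.
rewrite -(cent1_maxcyclic pivH mA nsAH Ad nZd) setISS // -cent_set1 centS //.
by rewrite sub1set.
Qed.

(** The abelian [C <*> Z] cannot be [H]: then [H] would be its own center, hence central in [G],
    contrary to [nsAHZ]. *)
Lemma center_sub_C : Z \subset C.
Proof.
have sCZH: C <*> Z \subset H by rewrite join_subG sCH.
have abCZ: abelian (C <*> Z).
  by rewrite abelianY center_abelian abC subIset // centS ?orbT.
have [defC|defH|defG] :=
    over_maxcyclic pivH mC sCH (joing_subl _ _) (subset_trans sCZH sHG).
- by rewrite -defC joing_subr.
- have [d /setIP[Ad Hd] nZd] := subsetPn nsAHZ.
  case/negP: nZd; apply: (subsetP center_pivot_sub).
  by rewrite (center_idP _) // -defH.
by rewrite defG in sCZH; have := pivot_proper pivH; rewrite properE sCZH andbF.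
Qed.

Lemma C_cap_maxcyclic B : maxcyclic G B -> ~~ (B \subset H) -> C :&: B \subset Z.
Proof.
move=> mB nsBH; apply/subsetP=> d /setIP[Cd Bd]; apply: contraR (nsBH) => nZd.
have sCB: C \subset B.
  rewrite -(cent1_maxcyclic pivH mB nsBH Bd nZd) subsetI sCG sub_cent1.
  exact: (subsetP abC).
by rewrite (maxcyclic_max mC (maxcyclic_sub mB) (maxcyclic_cyclic mB) sCB).
Qed.

Let C_not_sub_center : ~~ (C \subset Z).
Proof.
apply: contra nsAH => sCZ; have sCA := subset_trans sCZ sZA.
by rewrite (maxcyclic_max mC sAG cycA sCA).
Qed.

Let sub_C_or_H (K : {group gT}) : C \subset K -> K \subset H -> K :=: C \/ K :=: H.
Proof.
move=> sCK sKH; have sKG := subset_trans sKH sHG.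
have [||defG] := over_maxcyclic pivH mC sCH sCK sKG; [by left | by right | ].
by have := pivot_proper pivH; rewrite properE -{2}defG sKH andbF.
Qed.

(** At least half of [B] lies outside [Z], and the [#|H : B|] conjugates of [B :\: Z] are
    disjoint. *)
Let TI_count (B : {group gT}) :
    ~~ (B \subset Z) -> Z \subset B -> B \subset H -> normedTI (B :\: Z) H B ->
  #|H| <= 2 * #|class_support (B :\: Z) H|.
Proof.
move=> nsBZ sZB sBH /card_support_normedTI->.
rewrite -[leqLHS](Lagrange sBH) mulnA leq_pmul2r // cardsD (setIidPr sZB).
have le2B: 2 * #|Z| <= #|B|.
  by rewrite -(Lagrange sZB) mulnC leq_pmul2l // indexg_gt1.
by rewrite mulnBr [X in X - _]mul2n -addnn -addnBA // leq_addr.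
Qed.

Let TI_intro (B : {group gT}) :
    abelian B -> ~~ (B \subset Z) -> B \subset H ->
    (forall a g, a \in B -> a \notin Z -> g \in H -> a ^ g \in B -> g \in B) ->
  normedTI (B :\: Z) H B.
Proof.
move=> abB nsBZ sBH TI; apply/normedTI_memJ_P; split=> //.
  by rewrite setD_eq0.
move=> a g /setDP[Ba nZa] Hg; rewrite inE; apply/andP/idP=> [[_]|Bg].
  exact: TI.
by rewrite /conjg (centsP abB _ Ba _ Bg) mulKg Ba nZa.
Qed.

(* Were C and A :&: H both self-normalizing in H, the H-conjugates of C :\: Z
   and of (A :&: H) :\: Z would be disjoint and each fill at least half of H. *)
Lemma C_normal_pivot : C <| H.
Proof.
rewrite /normal sCH; apply/setIidPl.
have sCN: C \subset 'N_H(C) by rewrite subsetI sCH normG.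
have [defN|//] := sub_C_or_H sCN (subsetIl _ _).
have centC a: a \in C -> a \notin Z -> 'C_H[a] = C.
  move=> Ca nZa; have sCC: C \subset 'C_H[a].
    by rewrite subsetI sCH sub_cent1 (subsetP abC).
  have [//|defH] := sub_C_or_H sCC (subsetIl _ _).
  case/negP: nZa; apply: (subsetP center_pivot_sub).
  by rewrite inE (subsetP sCH) //= -sub_cent1; apply/setIidPl.
have tiC: normedTI (C :\: Z) H C.
  apply: TI_intro => // a g Ca nZa Hg Cag.
  rewrite -defN inE Hg inE; have Gg := subsetP sHG g Hg.
  have nZag: a ^ g \notin Z by rewrite memJ_norm // (subsetP (gFnorm _ _)).
  have := subxx 'C_H[a ^ g]; rewrite {2}(centC _ Cag nZag) cent1J.
  by rewrite -{1}(conjGid Hg) -conjIg (centC a Ca nZa).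
have tiA: normedTI ((A :&: H) :\: Z) H (A :&: H)%G.
  apply: TI_intro => [|||a g /setIP[Aa _] nZa Hg /setIP[Aag _]] //=.
  - exact: abelianS (subsetIl _ _) abA.
  - exact: subsetIr.
  rewrite inE Hg andbT; have Gg := subsetP sHG g Hg; apply: contraR nZa => nAg.
  have nAgV: g^-1 \notin A by rewrite groupV.
  have Ga := subsetP sAG a Aa.
  apply: (subsetP (maxcyclic_TI pivH mA nsAH nnA (groupVr Gg) nAgV)).
  by rewrite inE Aa mem_conjgV.
have leC := TI_count C_not_sub_center center_sub_C sCH tiC.
have sZAH: Z \subset A :&: H by rewrite subsetI sZA.
have leA := TI_count nsAHZ sZAH (subsetIr _ _) tiA.
set S1 := class_support _ _ in leC; set S2 := class_support _ _ in leA.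
(* A common element would place a noncentral element of [C] in a conjugate of [A], which is again a
   maximal cyclic subgroup outside [H]. *)
have tiS: S1 :&: S2 = set0.
  apply/eqP; rewrite -subset0; apply/subsetP=> x /setIP[].
  case/imset2P=> c h /setDP[Cc nZc] Hh -> /imset2P[a k /setDP[/setIP[Aa _] _] Hk].
  move/(canRL (conjgK h)); rewrite -conjgM => def_c.
  have Gg: k * h^-1 \in G by rewrite (subsetP sHG) // groupM ?groupV.
  have mB := maxcyclicJ Gg mA.
  case/negP: nZc; apply: (subsetP (C_cap_maxcyclic mB _)).
    by rewrite /= -(normsP (normal_norm nsHG) _ Gg) conjSg.
  by rewrite inE Cc def_c memJ_conjg.
(* The identity is missed by both sets, whose sizes add up to at least [#|H|]: this one element
   gives the contradiction. *)
have sSH: S1 :|: S2 \subset H^#.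
  have supp (B : {group gT}): B \subset H -> class_support (B :\: Z) H \subset H^#.
    move=> sBH; apply/subsetP=> _ /imset2P[b h /setDP[Bb nZb] Hh ->].
    apply/setD1P; split; last by rewrite groupJ // (subsetP sBH).
    by rewrite conjg_eq1; apply: contraNneq nZb => ->; apply: group1.
  by rewrite subUset supp //= (supp (A :&: H)%G) ?subsetIr.
have := subset_leq_card sSH; rewrite cardsU tiS cards0 subn0.
move/(leq_mul (leqnn 2)); rewrite mulnDr.
move/(leq_trans (leq_add leC leA)); rewrite addnn -mul2n leq_pmul2l //.
by rewrite [in X in X <= _](cardsD1 1 H) group1 ltnn.
Qed.

(** A different conjugate [D] would give [H = C D] with [C :&: D] central, so the derived subgroup
    of [H] is central. Conjugating a noncentral [d] of [A :&: H] by any [h] in [H] then multiplies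
    it by a central element and keeps it in [A]; trivial intersection puts [h] in [A], but [H] is
    not cyclic. *)
Lemma C_normal : C <| G.
Proof.
rewrite /normal sCG; apply/subsetP=> g Gg; rewrite inE.
pose D := (C :^ g)%G; apply: contraR pivot_not_subA => nsDC.
have [_ nCH] := andP C_normal_pivot.
have sDH: D \subset H by rewrite -(normsP (normal_norm nsHG) _ Gg) conjSg.
have abD: abelian D by rewrite abelianJ.
have defH: C <*> D = H.
  have sCDH: C <*> D \subset H by rewrite join_subG sCH.
  have [defC|//] := sub_C_or_H (joing_subl C D) sCDH.
  by case/negP: nsDC; have := joing_subr C D; rewrite defC.
have nCD: D \subset 'N(C) := subset_trans sDH nCH.
have nDC: C \subset 'N(D).
  have nDH: H \subset 'N(D) by rewrite normJ -(normsP (normal_norm nsHG) _ Gg) conjSg.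
  exact: subset_trans sCH nDH.
have sCDZ: C :&: D \subset Z.
  apply: subset_trans center_pivot_sub.
  rewrite subsetI subIset ?sCH //= -defH centY subsetI.
  by rewrite (subset_trans (subsetIl _ _) abC) (subset_trans (subsetIr _ _) abD).
have nZ (K : {group gT}) : K \subset G -> K \subset 'N(Z).
  by move=> sKG; apply: subset_trans sKG (gFnorm _ _).
have derHZ: H^`(1) \subset Z.
  rewrite der1_min ?nZ // -defH norm_joinEr // quotientMl ?nZ //.
  rewrite abelianM !quotient_abelian //= quotient_cents2 ?nZ ?(subset_trans sDH) //.
  apply: subset_trans sCDZ; rewrite subsetI.
  by rewrite commg_subr nCD commg_subl nDC.
have [d /setIP[Ad Hd] nZd] := subsetPn nsAHZ.
apply/subsetP=> h Hh; apply: contraR nZd => nAh.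
have Gh := subsetP sHG h Hh.
have Adh: d ^ h \in A.
  by rewrite conjg_mulR groupM // (subsetP sZA) // (subsetP derHZ) // mem_commg.
have nAhV: h^-1 \notin A by rewrite groupV.
apply: (subsetP (maxcyclic_TI pivH mA nsAH nnA (groupVr Gh) nAhV)).
by rewrite inE Ad mem_conjgV.
Qed.

(** [E] is recovered as [(C <*> E) :&: A], so the values [C], [H], [G] of [C <*> E] leave only [Z],
    [A :&: H] and [A]. *)
Lemma index_center_square : exists2 q, prime q & #|A : Z| = (q ^ 2)%N.
Proof.
apply: (@cyclic_index_square _ A 'Z(G)%G (A :&: H)%G) => //=.
- by rewrite properE subsetI sZA sZH.
- by rewrite properE subsetIl subsetI subxx.
move=> E sZE sEA; have sEG := subset_trans sEA sAG.
have nCE: E \subset 'N(C) := subset_trans sEG (normal_norm C_normal).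
have capA: (C <*> E) :&: A = E.
  rewrite norm_joinEr // setIC -group_modr // mulSGid //=.
  by rewrite setIC (subset_trans (C_cap_maxcyclic mA nsAH)).
have sCEG: C <*> E \subset G by rewrite join_subG sCG.
have [def|def|def] := over_maxcyclic pivH mC sCH (joing_subl C E) sCEG.
- constructor 1; apply/eqP; rewrite eqEsubset sZE andbT -capA def.
  exact: C_cap_maxcyclic.
- by constructor 2; rewrite -capA def setIC.
by constructor 3; rewrite -capA def; apply/setIidPr.
Qed.

Lemma pcore_not_central : exists2 p, prime p & ~~ ('O_p(C) \subset Z).
Proof.
have: ~~ (<<\bigcup_(V : {group gT} | Sylow C V) V>> \subset Z).
  by rewrite Sylow_gen.
rewrite gen_subG => /subsetPn[x /bigcupP[V sylV Vx] nZx].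
have /andP[/p_groupP[p pr_p pV] /andP[sVC _]] := sylV.
exists p => //; apply/subsetPn; exists x => //; apply: subsetP Vx.
by rewrite (sub_Hall_pcore (nilpotent_pcore_Hall p (abelian_nil abC))).
Qed.

Theorem large_intersection_family_iii : family_iii G.
Proof.
have [p pr_p nsPZ] := pcore_not_central; set P := 'O_p(C) in nsPZ.
have pP: p.-group P := pcore_pgroup p C.
have sPC: P \subset C := pcore_sub p C.
have nsPG: P <| G := gFnormal_trans _ C_normal.
have cycP: cyclic P := cyclicS sPC cycC.
have sPAZ: P :&: A \subset Z := subset_trans (setSI _ sPC) (C_cap_maxcyclic mA nsAH).
have nsPA: ~~ (P \subset A).
  by apply: contra nsPZ => sPA; apply: subset_trans sPAZ; rewrite subsetI subxx.
have sZpP: 'O_p(Z) \subset P.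
  rewrite (sub_Hall_pcore (nilpotent_pcore_Hall p (abelian_nil abC))).
    exact: pcore_pgroup.
  exact: subset_trans (pcore_sub _ _) center_sub_C.
have defG := sdprod_pcore_compl pivH nnilG mA nsAH pP nsPG nsPA sZpP.
have iK := index_cent_compl pivH nnilG mA nsAH pP nsPG nsPA.
have [q pr_q iA] := index_center_square.
have ntP: P != 1 by apply: contraNneq nsPZ => ->; apply: sub1G.
have [_ _ [n oP]] := pgroup_pdiv pP ntP.
have cycK: cyclic 'O_p^'(A) := cyclicS (pcore_sub _ _) cycA.
apply: (family_iii_intro defG cycK pr_p (ltn0Sn n) _ cycP oP _ pr_q).
- by apply: pnat_coprime (pcore_pgroup p^' A); apply: pnat_id.
(* [U] is normal, so it is central once inside [A]. If not inside, it supplements [A]. As [P] is not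
   in [A], the order of [A :&: P] is at most [p ^ n], so [A :&: P] lies in [U], and Dedekind yields
   [P = U]. *)
- move=> U sUP oU; have nsUG: U <| G.
    by apply: char_normal_trans nsPG; rewrite sub_cyclic_char.
  have sUZ: U \subset Z.
    have [sUA | nsUA] := boolP (U \subset A).
      exact: (normal_sub_center pivH mA nsAH nnA).
    case/negP: (nsPA); have defUA := mul_not_sub pivH mA nsAH nsUG nsUA.
    have sAPU: A :&: P \subset U.
      rewrite -(cardSg_cyclic cycP) ?subsetIr // oU.
      have: #|A :&: P| %| p ^ n.+1 by rewrite -oP cardSg ?subsetIr.
      case/(dvdn_pfactor _ _ pr_p)=> m.
      rewrite leq_eqVlt ltnS => /predU1P[->|]; last first.
        by move=> le_mn ->; rewrite dvdn_exp2l.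
      rewrite -oP => oAP; case/negP: (nsPA).
      suffices <-: A :&: P = P by apply: subsetIl.
      by apply/eqP; rewrite eqEcard subsetIr oAP /=.
    have := group_modl A sUP; rewrite defUA (setIidPr (normal_sub nsPG)).
    rewrite mulGSid // => defU; have := oU; rewrite defU oP.
    by move/eqP; rewrite eqn_exp2l ?prime_gt1 // gtn_eqF.
  rewrite centsC; apply: subset_trans sUZ _; rewrite subIset // centS ?orbT //.
  exact: subset_trans (pcore_sub _ _) sAG.
by rewrite iK.
Qed.

End LargeIntersection.

Lemma card_orbits_prime_index (gT : finGroupType) (r : nat) (K : {group gT})
    (S : {set gT}) :
    K \subset 'N(S) -> {in S, forall y, #|K : 'C_K[y]| = r} -> r %| #|S|.
Proof.
move=> nSK iK; have actK: [acts K, on S | 'J] by rewrite astabsJ.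
rewrite (card_uniform_partition (n := r) _ (orbit_partition actK)) ?dvdn_mull //.
by move=> _ /imsetP[y Sy ->]; rewrite card_orbit astab1J iK.
Qed.

(** * All maximal cyclic subgroups outside H meet H inside the center *)

Section SmallIntersection.

Variables (gT : finGroupType) (G H : {group gT}).
Implicit Types B D E : {group gT}.
Hypotheses (pivH : pivot G H) (nnilG : ~~ nilpotent G).
Hypothesis capZ :
  forall B, maxcyclic G B -> ~~ (B \subset H) -> B :&: H \subset 'Z(G).

Local Notation Z := 'Z(G).
Let sHG : H \subset G. Proof. exact: (proper_sub (pivot_proper pivH)). Qed.
Let nsHG : H <| G. Proof. exact: (pivot_normal pivH). Qed.
Let sZH : Z \subset H. Proof. exact: (center_sub_pivot pivH nnilG). Qed.

(** By Frattini some [g] outside [H] normalizes [P]. For [A] maximal cyclic above [g], the index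
    [#|A : Z|] is the prime [#|G : H|], so [Z] and [g] generate [A], and both normalize [P]. *)
Lemma maxcyclic_norm_Sylow (P : {group gT}) (p : nat) :
    p.-Sylow(H) P ->
  exists2 A, maxcyclic G A
    & [/\ ~~ (A \subset H), A \subset 'N(P) & prime #|A : Z|].
Proof.
move=> sylP; have defG := Frattini_arg nsHG sylP.
have [g /setIP[Gg nPg] nHg]: exists2 g, g \in 'N_G(P) & g \notin H.
  apply/subsetPn; apply: contraL (pivot_proper pivH) => sNH.
  by rewrite properE sHG negbK -defG mul_subG.
have [A mA [Ag nsAH]] := maxcyclic_not_sub Gg nHg; exists A => //.
have sAG := maxcyclic_sub mA.
have sZA := center_sub_maxcyclic pivH nnilG mA nsAH.
have defAH : A :&: H = Z.
  by apply/eqP; rewrite eqEsubset capZ // subsetI sZA.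
have HAG: H * A = G := mulg_normal_maximal nsHG (pivot_maximal pivH) sAG nsAH.
have prAZ: prime #|A : Z|.
  by rewrite -defAH indexgI -indexMg HAG (pivot_index_prime pivH).
split=> //; pose E := ('Z(G) <*> <[g]>)%G.
have sEA: E \subset A by rewrite join_subG sZA cycle_subG.
have iE: #|A : E| = 1%N.
  have: #|E : Z| != 1%N.
    rewrite indexg_eq1; apply: contra nHg => sEZ.
    by rewrite -cycle_subG (subset_trans (joing_subr _ _) (subset_trans sEZ sZH)).
  have iEZ: #|E : Z| %| #|A : Z|.
    by rewrite -(Lagrange_index sEA (joing_subl _ _)) dvdn_mull.
  move=> iE1; have := Lagrange_index sEA (joing_subl 'Z(G) <[g]>).
  rewrite (prime_nt_dvdP prAZ iE1 iEZ) -[RHS]mul1n => /eqP.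
  by rewrite eqn_pmul2r ?prime_gt0 // => /eqP.
move/eqP: iE; rewrite indexg_eq1 => /subset_trans-> //.
rewrite join_subG cycle_subG nPg andbT.
have sPG := subset_trans (pHall_sub sylP) sHG.
by rewrite cents_norm // subIset // centS ?orbT.
Qed.

Section Pivotal.

Variables (p : nat) (P A : {group gT}).
Hypotheses (pr_p : prime p) (sylP : p.-Sylow(H) P) (p_dv : p %| #|H : Z|).
Hypotheses (mA : maxcyclic G A) (nsAH : ~~ (A \subset H)).
Hypotheses (nPA : A \subset 'N(P)) (prAZ : prime #|A : Z|).

Let pP : p.-group P. Proof. exact: pHall_pgroup sylP. Qed.
Let sPH : P \subset H. Proof. exact: pHall_sub sylP. Qed.
Let sPG : P \subset G. Proof. exact: subset_trans sPH sHG. Qed.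
Let sAG : A \subset G. Proof. exact: (maxcyclic_sub mA). Qed.
Let cycA : cyclic A. Proof. exact: (maxcyclic_cyclic mA). Qed.
Let abA : abelian A. Proof. exact: (cyclic_abelian cycA). Qed.
Let sZA : Z \subset A.
Proof. exact: (center_sub_maxcyclic pivH nnilG mA nsAH). Qed.
Let nnA : ~~ (A <| G). Proof. exact: (maxcyclic_nonnormal pivH nnilG mA nsAH). Qed.

Let nsPZ : ~~ (P \subset Z).
Proof.
have p'HP : ~~ (p %| #|H : P|).
  by rewrite -p'natE //; case/and3P: sylP.
apply: contra p'HP => sPZ; apply: dvdn_trans p_dv _.
by rewrite -(Lagrange_index sZH sPZ) dvdn_mulr.
Qed.

Let nsPA : ~~ (P \subset A).
Proof.
apply: contra nsPZ => sPA; apply: subset_trans (capZ mA nsAH).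
by rewrite subsetI sPA.
Qed.

Let nsPG : P <| G.
Proof.
rewrite /normal sPG -(join_not_sub pivH mA nsAH sPG nsPA) join_subG normG.
exact: nPA.
Qed.

Let nsPH : P <| H. Proof. exact: normalS sPH sHG nsPG. Qed.

Let sub_sylow (E : {group gT}) : E \subset H -> p.-group E -> E \subset P.
Proof. by move=> sEH; rewrite (sub_normal_Hall sylP nsPH). Qed.

Let sZpP : 'O_p(Z) \subset P.
Proof.
by apply: sub_sylow; rewrite ?pcore_pgroup // (subset_trans (pcore_sub _ _)).
Qed.

Let K := 'O_p^'(A)%G.
Let N := 'O_p^'('Z(G))%G.

Let defG : P ><| K = G.
Proof. exact: (sdprod_pcore_compl pivH nnilG mA nsAH pP nsPG nsPA sZpP). Qed.

Let prK : prime #|K : 'C_K(P)|.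
Proof. by rewrite (index_cent_compl pivH nnilG mA nsAH pP nsPG nsPA). Qed.

Let cycK : cyclic K. Proof. exact: cyclicS (pcore_sub _ _) cycA. Qed.
Let sKA : K \subset A. Proof. exact: pcore_sub. Qed.
Let copK : coprime p #|K|.
Proof. by apply: pnat_coprime (pcore_pgroup p^' A); apply: pnat_id. Qed.

Let capPA : P :&: A \subset Z.
Proof.
apply: subset_trans (capZ mA nsAH); rewrite setIC subsetI subsetIl.
exact: subset_trans (subsetIr _ _) sPH.
Qed.

(** Dedekind on [G = P A] shows that [H] is the product of [P] and [A :&: H], the latter being
    [Z]. *)
Let defH : P \x N = H.
Proof.
have [_ defZ _ _] := dprodP (nilpotent_pcoreC p (abelian_nil (center_abelian G))).
have defPA := mul_not_sub pivH mA nsAH nsPG nsPA.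
have defPZ: P * Z = H.
  have sGHPZ: G :&: H \subset P * Z.
    by rewrite -{1}defPA -group_modl // mulgS ?capZ.
  by rewrite (setIidPr sHG) in sGHPZ; apply/eqP; rewrite eqEsubset mul_subG.
rewrite dprodE.
- by rewrite -defPZ -[in RHS]defZ mulgA (mulGSid sZpP).
- rewrite (subset_trans (pcore_sub _ _)) // subIset // centS ?orbT //.
by apply: coprime_TIg; apply: pnat_coprime pP (pcore_pgroup _ _).
Qed.

Let p'N : p^'.-group N. Proof. exact: pcore_pgroup. Qed.
Let sNK : N \subset K.
Proof.
rewrite (sub_Hall_pcore (nilpotent_pcore_Hall _ (abelian_nil abA))) //.
exact: subset_trans (pcore_sub _ _) sZA.
Qed.
Let cycN : cyclic N. Proof. exact: cyclicS sNK cycK. Qed.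

(** If [E] is not in [A] it supplements [A], so [P] is the product of [E] and the central [P :&: A].
    This amounts to irreducibility modulo the center. *)
Let normal_sub E : E <| G -> E \subset P -> E \subset Z \/ E * (P :&: Z) = P.
Proof.
move=> nsEG sEP; have [sEA | nsEA] := boolP (E \subset A).
  by left; apply: (normal_sub_center pivH mA nsAH nnA).
right; have := group_modl A sEP; rewrite setIC.
rewrite (mul_not_sub pivH mA nsAH nsEG nsEA) (setIidPr sPG) => defP.
apply/eqP; rewrite eqEsubset mul_subG ?subsetIl //= -{1}defP mulgS //.
by rewrite subsetI subsetIl.
Qed.

Let ncP : ~~ cyclic P.
Proof.
apply: contra (pivot_noncyclic pivH) => cycP.
have := cyclic_join_compl defH pP p'N cycN (subxx P) cycP.
by rewrite (dprodWY defH).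
Qed.

(** [D] is [D :&: P] times [N]. For [L] between [D :&: P] and [P], the group [L <*> N] lies between
    [D] and [H], where nothing else occurs. *)
Let maxcyclic_of y D : y \in P -> y \notin Z -> maxcyclic G D -> y \in D ->
  [/\ D \subset H, maximal (D :&: P) P & D \subset (D :&: P) <*> N].
Proof.
move=> Py nZy mD Dy; have sDH: D \subset H.
  apply: contraR (nZy) => nsDH; apply: (subsetP (capZ mD nsDH)).
  by rewrite inE Dy (subsetP sPH).
have sDN := sub_cap_join_compl defH pP p'N sDH; split=> //.
have sNH: N \subset H by case/dprodP: defH => _ <- _ _; rewrite mulG_subr.
have cycD := maxcyclic_cyclic mD.
have defD: (D :&: P) <*> N = D.
  apply: (maxcyclic_max (K := ((D :&: P) <*> N)%G) mD) => //=.
    by rewrite join_subG !subIset ?(subset_trans sPG) ?(maxcyclic_sub mD) //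
      (subset_trans sNH).
  apply: (cyclic_join_compl defH pP p'N) => //; first exact: subsetIr.
  exact: cyclicS (subsetIl _ _) cycD.
apply/maxgroupP; split=> [|L pLP sDL].
  rewrite properE subsetIr /=; apply: contra ncP => sPD.
  by apply: cyclicS cycD; apply: subset_trans sPD (subsetIl _ _).
have sLP := proper_sub pLP.
have sDLN: D \subset L <*> N.
  by apply: subset_trans sDN _; rewrite genS ?setSU.
have sLNH: L <*> N \subset H by rewrite join_subG sNH (subset_trans sLP).
have capL := join_compl_cap defH sLP.
have [def|def|def] := over_maxcyclic pivH mD sDH sDLN (subset_trans sLNH sHG).
- by rewrite -capL def.
- by move: pLP; rewrite -capL def (setIidPr sPH) properxx.
by have := pivot_proper pivH; rewrite properE -{2}def sLNH andbF.
Qed.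

Let sPhiZ : 'Phi(P) \subset Z.
Proof.
have [//|defP] := normal_sub (gFnormal_trans _ nsPG) (Phi_sub P).
case/negP: nsPZ; apply/setIidPl.
have := @Phi_nongen _ P (P :&: Z); rewrite genGid; apply.
by rewrite norm_joinEr // (subset_trans (subsetIl _ _)) ?gFnorm.
Qed.

Let prime_order_central (D : {group gT}) y z :
  cyclic D -> y \in D -> z \in D -> #[y] = p -> #[z] = p -> z \in Z -> y \in Z.
Proof.
move=> cycD Dy Dz oy oz Zz; have: <[y]> == <[z]>.
  by rewrite (eq_subG_cyclic cycD) ?cycle_subG // -!orderE oy oz.
by move/eqP=> eq_yz; rewrite -cycle_subG eq_yz cycle_subG.
Qed.

(** [W] meets [Z] trivially by coprime action, so it is elementary abelian. A nontrivial [y] in [W]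
    generates [D :&: P], so [D] lies in [W <*> K], which is not inside [H] and must be [G]. Hence
    [W = P], of order [p ^ 2] as [<[y]>] is maximal in it. *)
Let abelian_family_iv : abelian P -> family_iv G.
Proof.
move=> abP; have [_ defPK nPK _] := sdprodP defG.
have coPK: coprime #|P| #|K| := pnat_coprime pP (pcore_pgroup _ _).
pose W := [~: P, K]%G; have sWP: W \subset P by rewrite commg_subl.
have nsWG: W <| G.
  rewrite /normal (subset_trans sWP) //= -defPK mul_subG ?commg_normr //.
  exact: sub_abelian_norm.
have tiWZ: W :&: Z = 1.
  apply/trivgP; rewrite -(coprime_abel_cent_TI nPK coPK abP) setIS //.
  by rewrite subIset // centS ?orbT // (subset_trans sKA).
have ntW: W :!=: 1.
  apply: contra nsPZ => /eqP/commG1P cPK; rewrite subsetI sPG -defPK centM.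
  by rewrite subsetI -abelianE abP.
have abelW: p.-abelem W.
  rewrite -(trivg_Phi (pgroupS sWP pP)); apply/eqP/trivgP.
  rewrite -tiWZ subsetI Phi_sub; exact: subset_trans (PhiS pP sWP) sPhiZ.
have [y Wy nty] := trivgPn _ ntW; have oy: #[y] = p := abelem_order_p abelW Wy nty.
have nZy: y \notin Z.
  by apply: contra nty => Zy; rewrite -in_set1 -[[set 1]]tiWZ inE Wy.
have Py := subsetP sWP y Wy.
have [D mD Dy] := maxcyclic_exists (subsetP sPG y Py).
have [sDH maxDP sDN] := maxcyclic_of Py nZy mD Dy.
have cycD := maxcyclic_cyclic mD.
have cycDP: cyclic (D :&: P) := cyclicS (subsetIl _ _) cycD.
have [x defDP] := cyclicP cycDP.
have /setIP[Dx Px]: x \in D :&: P by rewrite defDP cycle_id.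
(* Otherwise [x ^+ p], which is central, would give the cyclic [D] a central subgroup of order [p],
   necessarily [<[y]>]. *)
have xp1: x ^+ p = 1.
  apply/eqP; rewrite -order_eq1; apply: contraR nZy; rewrite order_eq1 => ntxp.
  have Zxp: x ^+ p \in Z.
    apply: (subsetP sPhiZ); rewrite (Phi_joing pP) mem_gen // inE orbC.
    by rewrite (Mho_p_elt 1) ?(mem_p_elt pP).
  have ntXp: <[x ^+ p]> != 1 by rewrite cycle_eq1.
  have pXp: p.-group <[x ^+ p]> by apply: mem_p_elt (groupX p Px).
  have [_ p_dv_Xp _] := pgroup_pdiv pXp ntXp.
  have [z Xpz oz] := Cauchy pr_p p_dv_Xp.
  have [Dz Zz]: z \in D /\ z \in Z.
    by split; apply: subsetP Xpz; rewrite cycle_subG // groupX.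
  exact: (prime_order_central cycD Dy Dz oy oz Zz).
have oDP: #|D :&: P| = p.
  apply/eqP; rewrite eqn_dvd {1}defDP -orderE order_dvdn xp1 eqxx /=.
  by rewrite -oy order_dvdG // inE Dy.
have defDPy: D :&: P = <[y]>.
  by apply/eqP; rewrite eq_sym eqEcard cycle_subG inE Dy Py oDP -orderE oy /=.
have sDWK: D \subset W <*> K.
  apply: subset_trans sDN _; rewrite defDPy join_subG cycle_subG.
  by rewrite (subsetP (joing_subl _ _)) // (subset_trans sNK) ?joing_subr.
have sWKG: W <*> K \subset G.
  by rewrite join_subG (subset_trans sWP) // (subset_trans sKA).
have nsKH: ~~ (K \subset H).
  apply: contra nsAH => sKH.
  have [_ <- _ _] := dprodP (nilpotent_pcoreC p (abelian_nil abA)).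
  rewrite mul_subG // (subset_trans _ sZH) //.
  exact: (pcore_maxcyclic_central pivH nnilG mA nsAH pP nsPG nsPA).
have defWK: W <*> K = G.
  have nWKH: ~~ (W <*> K \subset H).
    by apply: contra nsKH; apply: subset_trans (joing_subr _ _).
  have [def|def|//] := over_maxcyclic pivH mD sDH sDWK sWKG.
    by rewrite def sDH in nWKH.
  by rewrite def subxx in nWKH.
have defW: W :=: P.
  have := setIidPr sPG; rewrite -{1}defWK norm_joinEr; last first.
    by rewrite (subset_trans sKA) // (subset_trans sAG) ?normal_norm.
  by rewrite -group_modl // setIC coprime_TIg // mulg1.
have oP: #|P| = (p ^ 2)%N.
  by rewrite -(Lagrange (subsetIr D P)) oDP (p_maximal_index pP maxDP) mulnn.
have tiPZ: P :&: Z = 1 by rewrite -defW.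
apply: (family_iv_intro defG cycK pr_p copK _ oP _ prK erefl).
  by rewrite -defW.
move=> E sEP nEK; have nsEG: E <| G.
  rewrite /normal (subset_trans sEP) //= -defPK mul_subG //.
  exact: sub_abelian_norm.
have [sEZ|] := normal_sub nsEG sEP; last by rewrite tiPZ mulg1; right.
by left; apply/trivgP; rewrite -tiPZ subsetI sEP.
Qed.

(** A maximal cyclic [D] above a noncentral [y] contains [P :&: Z], else [D :&: P] and [P :&: Z]
    would make [P] abelian. So elements of order [p] in [P] are central, and [P] is generalized
    quaternion. *)
Let nonabelian_family_v : ~~ abelian P -> family_v G.
Proof.
move=> nabP; have [_ defPK nPK _] := sdprodP defG.
have maxcyclic_Z y D : y \in P -> y \notin Z -> maxcyclic G D -> y \in D ->
  P :&: Z \subset D.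
  move=> Py nZy mD Dy; have [sDH maxDP sDN] := maxcyclic_of Py nZy mD Dy.
  apply: contraR nabP => nsZD.
  have nsZDP: ~~ (P :&: Z \subset D :&: P).
    by apply: contra nsZD; rewrite subsetI => /andP[].
  have nsDPP := p_maximal_normal pP maxDP.
  rewrite -(mulg_normal_maximal nsDPP maxDP (subsetIl P Z) nsZDP).
  rewrite abelianM (abelianS (subsetIl D P) (cyclic_abelian (maxcyclic_cyclic mD))).
  rewrite (abelianS (subsetIr P Z) (center_abelian G)) /=.
  rewrite subIset // orbC subIset // centS ?orbT //.
  by rewrite subIset ?sPG ?orbT.
have ntPZ: P :&: Z != 1.
  apply: contra nabP => /eqP tiPZ; apply: (@abelem_abelian _ p).
  by rewrite -(trivg_Phi pP) -subG1 -tiPZ subsetI Phi_sub.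
have cycPZ: cyclic (P :&: Z) := cyclicS (subsetIr _ _) (cyclicS sZA cycA).
have [_ p_dv_PZ _] := pgroup_pdiv (pgroupS (subsetIl _ _) pP) ntPZ.
have [z /setIP[Pz Zz] oz] := Cauchy pr_p p_dv_PZ.
have [|p2 [n n_gt2 isoP]] :=
  unique_prime_subgroup_quaternion pP ncP (subsetIl P Z) cycPZ.
  move=> y Py oy; rewrite inE Py; apply: contraT => nZy.
  have [D mD Dy] := maxcyclic_exists (subsetP sPG y Py).
  have Dz: z \in D by rewrite (subsetP (maxcyclic_Z y D Py nZy mD Dy)) // inE Pz.
  by case/negP: nZy; apply: (prime_order_central (maxcyclic_cyclic mD) Dy Dz).
have oZP := card_center_quaternion n_gt2 isoP.
have sPZZ: P :&: Z \subset 'Z(P).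
  by rewrite subsetI subsetIl subIset // orbC subIset // centS ?orbT.
have oPZ: #|P :&: Z| = 2.
  by apply/prime_nt_dvdP; rewrite -?trivg_card1 // -oZP cardSg.
(* The Frattini subgroup of ['Q_(2 ^ n)] has order [2 ^ (n - 2)] and lies in [P :&: Z], of order
   2. *)
have n3: n = 3.
  have [[x y] genP _] := generators_quaternion n_gt2 isoP.
  have [_ [_ defPhi oder _] _ _ _] := quaternion_structure n_gt2 genP isoP.
  have: #|'Phi(P)| <= 2.
    by rewrite -oPZ subset_leq_card // subsetI Phi_sub sPhiZ.
  rewrite defPhi oder -{2}(expn1 2) leq_exp2l // => len1.
  by apply/eqP; rewrite eqn_leq n_gt2 andbT; case: (n) len1 => [|[|]].
rewrite {n n_gt2}n3 in isoP.
have oP: #|P| = 8 by rewrite (card_isog isoP) card_quaternion.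
have oddK: odd #|K| by rewrite -coprime2n -p2.
have centA y: y \in P -> y \notin Z -> ~~ (K \subset 'C[y]).
  move=> Py nZy; apply/negP=> cyK; case/negP: (nZy); apply: (subsetP capPA).
  have cyA: A \subset 'C_G[y].
    have [_ <- _ _] := dprodP (nilpotent_pcoreC p (abelian_nil abA)).
    rewrite subsetI mul_subG ?(subset_trans (pcore_sub _ _)) //= mul_subG //.
    rewrite sub_cent1; apply: subsetP Py; rewrite centsC.
    apply: subset_trans (pcore_maxcyclic_central pivH nnilG mA nsAH pP nsPG nsPA) _.
    by rewrite subIset // centS ?orbT.
  have [defC|defC] := maximal_over (maxcyclic_maximal pivH mA nsAH) cyA (subsetIl _ _).
    by rewrite inE Py -defC subcent1_id // (subsetP sPG).
  case/negP: nZy; rewrite inE (subsetP sPG) //= -sub_cent1.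
  by apply/setIidPl.
pose r := #|K : 'C_K(P)|.
have orbK y: y \in P :\: (P :&: Z) -> #|K : 'C_K[y]| = r.
  case/setDP=> Py; rewrite inE Py /= => nZy.
  have sCC: 'C_K(P) \subset 'C_K[y] by rewrite setIS // -cent_set1 centS ?sub1set.
  apply/(prime_nt_dvdP prK).
    rewrite indexg_eq1; apply: contra (centA y Py nZy) => sKC.
    exact: subset_trans sKC (subsetIr _ _).
  by rewrite -(Lagrange_index (subsetIl K 'C[y]) sCC) dvdn_mulr.
(* The [8 - 2] elements of [P] outside [Z] fall into orbits of the same length [r]: each stabilizer
   contains ['C_K(P)], of prime index [r], and is proper. Oddness of [#|K|] then leaves only 3. *)
have r_dv6: r %| 6.
  have oS: #|P :\: (P :&: Z)| = 6 by rewrite cardsD (setIidPr (subsetIl _ _)) oP oPZ.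
  rewrite -oS; apply: card_orbits_prime_index orbK.
  rewrite normsD // normsI // (subset_trans sKA) // (subset_trans sAG) //.
  exact: gFnorm.
have odd_r: odd r by apply: dvdn_odd oddK; apply: dvdn_indexg.
apply: (family_v_intro defG cycK isoP oddK).
move: (r_dv6) prK odd_r; rewrite -/r.
have := dvdn_leq (isT : 0 < 6) r_dv6.
by case: (r) => [|[|[|[|[|[|[|]]]]]]].
Qed.

Lemma pivotal_family : family_iv G \/ family_v G.
Proof.
by have [/abelian_family_iv|/nonabelian_family_v] := boolP (abelian P); [left | right].
Qed.

End Pivotal.

Lemma small_intersection_family : family_iv G \/ family_v G.
Proof.
have ntHZ: 1 < #|H : Z|.
  rewrite indexg_gt1; apply: contra (pivot_noncyclic pivH) => sHZ.
  have [g Gg nHg] := pivot_complement pivH.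
  have [A mA [_ nsAH]] := maxcyclic_not_sub Gg nHg.
  apply: cyclicS (maxcyclic_cyclic mA).
  exact: subset_trans sHZ (center_sub_maxcyclic pivH nnilG mA nsAH).
have [P sylP] := Sylow_exists (pdiv #|H : Z|) H.
have [A mA [nsAH nPA prAZ]] := maxcyclic_norm_Sylow sylP.
exact: (pivotal_family (pdiv_prime ntHZ) sylP (pdiv_dvd _) mA nsAH nPA prAZ).
Qed.

End SmallIntersection.

Theorem theorem1p1 (gT : finGroupType) (G : {group gT})
    (hG : num_irredundant_covers G = 2) :
  (nilpotent G -> family_i G \/ family_ii G) /\
  (~~ nilpotent G -> family_iii G \/ family_iv G \/ family_v G).
Proof.
have [H pivH] := two_covers_pivot hG; split=> [nilG | nnilG].
  exact: nilpotent_pivot_family nilG pivH.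
have [/existsP[A /and3P[mA nsAH nsAHZ]] | /existsPn capZ] :=
  boolP [exists A : {group gT},
    [&& maxcyclic G A, ~~ (A \subset H) & ~~ (A :&: H \subset 'Z(G))]].
  have [C mC sCH] := pivot_maxcyclic pivH; left.
  exact: large_intersection_family_iii pivH nnilG mA nsAH nsAHZ mC sCH.
right; apply: (small_intersection_family pivH nnilG) => B mB nsBH.
by have := capZ B; rewrite mB nsBH /= negbK.
Qed.
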